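(* Assume the setting of the context and let $H$ be a special atom. Then there exist constants $C_0,C_1>0$, depending only on the support window, the mask support, and the local complexity of $H$ (independent of $n$), such that for every $n\ge1$ the vector-valued function $\mathrm{Vec}(V^nH):[0,1]^2\to\mathbb{R}^{L_1L_2}$ is the restriction to $[0,1]^2$ of a network in $\Upsilon_{C_0,\,C_1n}(\mathrm{ReLU};2,L_1L_2)$. Moreover, the weights and biases of these networks can be chosen with magnitudes bounded by $C_2\Lambda^n$ for suitable constants $C_2,\Lambda>0$ depending only on the support window, the mask support, and $H$.
   Context: For integers $W,L,d,N\ge 1$, $\Upsilon_{W,L}(\mathrm{ReLU};d,N)$ denotes the set of functions $\mathbb{R}^d\to\mathbb{R}^N$ realized (exactly) by fully connected feed-forward ReLU networks of width $W$ and depth $L$. CPwL means continuous piecewise linear. Fix real coefficients $c_{j,k}$, $(j,k)\in\mathbb{Z}^2$, all but finitely many equal to zero, and define $(Vf)(x,y)=\sum_{(j,k)\in\mathbb{Z}^2}c_{j,k}f(2x-j,2y-k)$. Fix integers $L_1,L_2\ge1$ and assume the window $[0,L_1]\times[0,L_2]$ is preserved by $V$: $\operatorname{supp} f\subset[0,L_1]\times[0,L_2]\Rightarrow\operatorname{supp}(Vf)\subset[0,L_1]\times[0,L_2]$. Vectorization: for $1\le a\le L_1$, $1\le b\le L_2$, the patch $f_{a,b}(u,v)=f(u+a-1,v+b-1)$ for $(u,v)\in[0,1]^2$, and $\mathrm{Vec}(f)(u,v)=(f_{a,b}(u,v))_{a,b}\in\mathbb{R}^{L_1L_2}$ (fixed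 ordering of index pairs). Special atom: for fixed $0<\varrho<\frac12$, a special atom is a compactly supported nonnegative CPwL function $H:\mathbb{R}^2\to[0,\infty)$ with $\operatorname{supp}H\subset[\varrho,1-\varrho]^2$.
   Formalization: The constants C_2, Λ in the formal theorem may depend on the mask coefficients c_{j,k}, not only on the mask support; this is necessary, since scaling the mask scales VH without bound while networks with fixed width, depth and weight bounds stay bounded. *)

(* Defs.v *)
From HB Require Import structures.
From mathcomp Require Import all_boot all_order all_algebra.
From mathcomp Require Import all_classical all_reals all_analysis.
Set Implicit Arguments. Unset Strict Implicit. Unset Printing Implicit Defensive.
Import Order.TTheory GRing.Theory Num.Theory.
Import numFieldNormedType.Exports.
Local Open Scope ring_scope.

Section Defs.
Variable R : realType.

Definition relu_vec (k : nat) (v : 'cV[R]_k) : 'cV[R]_k :=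
  map_mx (fun t : R => Num.max t 0) v.

(** A fully connected feed-forward ReLU network R^d -> R^N whose hidden layers
    all have width W: input affine layer (A0,b0) : R^d -> R^W, a list of hidden
    affine layers R^W -> R^W, output affine layer (A,b) : R^W -> R^N.
    The ReLU is applied after every affine layer except the output one.
    Its depth (number of hidden layers) is (size rn_hid).+1. *)
Record relu_net (d W N : nat) := ReluNet {
  rn_A0 : 'M[R]_(W, d);
  rn_b0 : 'cV[R]_W;
  rn_hid : seq ('M[R]_W * 'cV[R]_W);
  rn_A : 'M[R]_(N, W);
  rn_b : 'cV[R]_N }.

Definition rn_depth d W N (net : relu_net d W N) : nat := (size (rn_hid net)).+1.

Definition rn_eval d W N (net : relu_net d W N) (x : 'cV[R]_d) : 'cV[R]_N :=
  let h0 := relu_vec (rn_A0 net *m x + rn_b0 net) in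
  let h := foldl (fun h p => relu_vec (p.1 *m h + p.2)) h0 (rn_hid net) in
  rn_A net *m h + rn_b net.

Definition mx_bounded m n (A : 'M[R]_(m, n)) (B : R) : Prop :=
  forall i j, `|A i j| <= B.

Definition rn_bounded d W N (net : relu_net d W N) (B : R) : Prop :=
  [/\ mx_bounded (rn_A0 net) B, mx_bounded (rn_b0 net) B,
      (forall p, p \in rn_hid net -> mx_bounded p.1 B /\ mx_bounded p.2 B),
      mx_bounded (rn_A net) B & mx_bounded (rn_b net) B].

Definition Upsilon (W L d N : nat) : set ('cV[R]_d -> 'cV[R]_N) :=
  [set f | exists net : relu_net d W N, rn_depth net = L /\ f = rn_eval net].

Definition Upsilon_bounded (W L d N : nat) (B : R) : set ('cV[R]_d -> 'cV[R]_N) :=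
  [set f | exists net : relu_net d W N,
     [/\ rn_depth net = L, rn_bounded net B & f = rn_eval net]].

Definition CPwL_pieces (K : nat) (f : R -> R -> R) : Prop :=
  continuous (fun p : R * R => f p.1 p.2) /\
  exists (a b e : 'I_K -> R),
    forall x y, exists i, f x y = a i * x + b i * y + e i.

Definition CPwL (f : R -> R -> R) : Prop := exists K, CPwL_pieces K f.

(** supp f ⊂ [x0,x1] x [y0,y1]  (the rectangle is closed, so this is equivalent
    to the nonzero set being contained in it). *)
Definition supp_in (f : R -> R -> R) (x0 x1 y0 y1 : R) : Prop :=
  forall x y, f x y != 0 -> (x0 <= x <= x1) /\ (y0 <= y <= y1).

(** Special atom for parameter rho: nonnegative CPwL with supp in [rho,1-rho]^2
    (compact support follows). *)
Definition special_atom (rho : R) (H : R -> R -> R) : Prop :=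
  [/\ CPwL H, (forall x y, 0 <= H x y) & supp_in H rho (1 - rho) rho (1 - rho)].

Definition mask_supported (M : nat) (c : int -> int -> R) : Prop :=
  forall j k : int, (M%:Z < `|j|)%R || (M%:Z < `|k|)%R -> c j k = 0.

(** Subdivision operator (Vf)(x,y) = sum_{(j,k) in Z^2} c_{j,k} f(2x-j,2y-k);
    for a mask supported in [-M,M]^2 the sum reduces to that box. *)
Definition Vop (M : nat) (c : int -> int -> R) (f : R -> R -> R) : R -> R -> R :=
  fun x y => \sum_(i < (M + M).+1) \sum_(l < (M + M).+1)
     c (i%:Z - M%:Z) (l%:Z - M%:Z) *
     f (2 * x - (i%:Z - M%:Z)%:~R) (2 * y - (l%:Z - M%:Z)%:~R).

Definition preserves_window (M : nat) (c : int -> int -> R) (L1 L2 : nat) : Prop :=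
  forall f : R -> R -> R, supp_in f 0 L1%:R 0 L2%:R ->
    supp_in (Vop M c f) 0 L1%:R 0 L2%:R.

(** Vec f (u,v): entry with index i (0-based) corresponds to the patch (a,b)
    with a-1 = i %/ L2, b-1 = i %% L2, i.e. f(u + a - 1, v + b - 1). *)
Definition Vec (L1 L2 : nat) (f : R -> R -> R) (u v : R) : 'cV[R]_(L1 * L2) :=
  \col_(i < L1 * L2) f (u + (i %/ L2)%:R) (v + (i %% L2)%:R).

Definition cx (x : 'cV[R]_2) : R := x ord0 ord0.
Definition cy (x : 'cV[R]_2) : R := x (@ord_max 1) ord0.

End Defs.

Arguments Upsilon {R} W L d N.
Arguments Upsilon_bounded {R} W L d N B.

(* Main.v *)
Require Import Defs.
From HB Require Import structures.
From mathcomp Require Import all_boot all_order all_algebra.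
From mathcomp Require Import all_classical all_reals all_analysis.
From mathcomp Require Import ring lra zify.
Import Order.TTheory GRing.Theory Num.Theory.
Import numFieldNormedType.Exports.
Local Open Scope ring_scope.

Set Implicit Arguments.
Unset Strict Implicit.
Unset Printing Implicit Defensive.

(* On a dyadic cell of level n the function V^n H is a constant times a copy of H,
   and along the binary digits e_1, e_2, ... of the point x the vectors satisfy
   Vec(V^{k+1} H)(x) = T_e Vec(V^k H)(2x - e).  A network processes the digits one
   by one, most significant first, with a constant number of layers per digit.
   Digits are read off by a steep ramp, and the network carries the current point x
   together with P, P x_1 and P x_2, where P = T_{e_1} T_{e_2} ... is the product of
   the matrices selected so far: these are updated linearly once the digit is known,
   and multiplication by a digit is a clipped ReLU expression.  At the end P H(x) must be
   formed from (P, P x_1, P x_2) although the sign of P is unknown; since H = max min l_i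
   is nonnegative, P H(x) is obtained from the affine forms P l_i(x) by max, min and a
   cap proportional to the positive part of P, applied to P and to -P.

   The ramps give wrong digits near dyadic points, but there V^n H vanishes because H
   is supported in [rho, 1 - rho]^2.  A flag accumulates how close the orbit came to
   such a point and closes the final cap.  All constants needed are of size C^n, and
   composing networks through the layer p = relu p - relu (-p) keeps weights bounded by
   the largest constant used. *)

(** * Max-min representation of piecewise affine functions *)

Section Lattice.
Local Open Scope classical_set_scope.
Variable R : realType.

(** Let u be the supremum of the t for which some piece lies above h at 0 and below h at t. If u <
    1, a slightly later t also qualifies. When the old piece touches h at u, the piece active at t
    either starts above h at 0, or starts below the old piece and meets it at u; in the latter case
    it is steeper and dominates the old piece at t. *)
Lemma affine_selection_line (K : nat) (h : R -> R) (a e : 'I_K -> R) :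
  continuous h -> (forall t, exists i, h t = a i * t + e i) ->
  exists i, h 0 <= e i /\ a i + e i <= h 1.
Proof.
move=> hc hs; pose l i t := a i * t + e i.
have lc i : continuous (l i).
  by move=> t; apply: cvgD; [apply: cvgM; [exact: cvg_cst|exact: cvg_id]|exact: cvg_cst].
pose T := [set t | 0 <= t <= 1 /\ exists i, h 0 <= e i /\ l i t <= h t].
have T0 : T 0.
  split; first by rewrite lexx ler01.
  have [i hi] := hs 0; exists i; rewrite /l mulr0 add0r.
  by move: hi; rewrite mulr0 add0r => ->.
have Tub : has_ubound T by exists 1 => t [/andP[_]].
have Tne : T !=set0 by exists 0.
pose u := sup T.
have u0 : 0 <= u by exact: ub_le_sup.
have u1 : u <= 1 by apply: ge_sup => // t [/andP[_]].
have near_gt i : h u < l i u -> \forall t \near u, h t < l i t.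
  move=> hu; have dc : (fun t => l i t - h t) @ u --> l i u - h u.
    by apply: cvgB; [exact: lc|exact: hc].
  have : \forall t \near u, 0 < l i t - h t.
    by apply: (cvgr_gt _ dc); rewrite subr_gt0.
  by apply: filterS => t; rewrite subr_gt0.
have near_lt i : l i u < h u -> \forall t \near u, l i t < h t.
  move=> hu; have dc : (fun t => h t - l i t) @ u --> h u - l i u.
    by apply: cvgB; [exact: hc|exact: lc].
  have : \forall t \near u, 0 < h t - l i t.
    by apply: (cvgr_gt _ dc); rewrite subr_gt0.
  by apply: filterS => t; rewrite subr_gt0.
(* There are finitely many pieces, so one neighbourhood of u preserves all strict inequalities at
   u. *)
have nearA : \forall t \near u, forall i,
    (h u < l i u -> h t < l i t) /\ (l i u < h u -> l i t < h t).
  have := @filter_forall _ _ (fun i t =>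
    (h u < l i u -> h t < l i t) /\ (l i u < h u -> l i t < h t)) _ (nbhs_filter u).
  apply => i.
  have [hlt|hlt|heq] := ltgtP (h u) (l i u).
  - by apply: filterS (near_gt _ hlt) => t.
  - by apply: filterS (near_lt _ hlt) => t.
  - by apply: nearW.
have [i [hi lu]] : exists i, h 0 <= e i /\ l i u <= h u.
  have /(_ _ nearA) [t [[_ [i [hi lt]]] /(_ i) [ht _]]] := closure_sup Tne Tub.
  exists i; split => //; rewrite leNgt; apply/negP => /ht.
  by rewrite ltNge lt.
have [u1'|u1'] := ltP u 1; last first.
  exists i; split => //; have <- : u = 1 by apply/le_anti; rewrite u1.
  by move: lu; rewrite /l (_ : u = 1) ?mulr1 //; apply/le_anti; rewrite u1.
have [t [ut t1 near_t]] : exists t, [/\ u < t, t < 1 & forall i,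
    (h u < l i u -> h t < l i t) /\ (l i u < h u -> l i t < h t)].
  have : \forall t \near u^'+, [/\ u < t, t < 1 & forall i,
    (h u < l i u -> h t < l i t) /\ (l i u < h u -> l i t < h t)].
    near=> t; split.
    - by near: t; exact: nbhs_right_gt.
    - by near: t; exact: nbhs_right_lt.
    - by near: t; exact: (@cvg_within _ (nbhs u) _ _ _ nearA).
  by move=> /filter_ex.
exfalso; suff Tt : T t by have := ub_le_sup Tub Tt; rewrite leNgt ut.
split; first by rewrite (ltW (le_lt_trans u0 ut)) ltW.
have [j hj] := hs t; have {}hj : h t = l j t by [].
have [lhi|hli] := ltP (l i u) (h u).
  by exists i; split => //; apply: ltW; apply: (near_t i).2.
have [hj0|hj0] := leP (h 0) (e j); first by exists j; split; rewrite // hj.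
have ju : l j u = h u.
  have [j1 j2] := near_t j; have [c|c|//] := ltgtP (l j u) (h u).
  - by have := j2 c; rewrite hj ltxx.
  - by have := j1 c; rewrite hj ltxx.
exists i; split => //; rewrite hj /l.
have eij : e j < e i by exact: lt_le_trans hj0 hi.
have eu : l i u = l j u by rewrite ju; apply/le_anti; rewrite lu.
rewrite /l in eu.
have hprod : (a j - a i) * u = e i - e j by lra.
have aji : a i < a j.
  rewrite ltNge; apply/negP => aji.
  have : (a j - a i) * u <= 0 by rewrite mulr_le0_ge0 // subr_le0.
  by rewrite hprod subr_le0 leNgt eij.
nra.
Unshelve. all: by end_near. Qed.

Lemma affine_selection_plane (K : nat) (f : R -> R -> R) (a b e : 'I_K -> R)
    (x0 y0 x1 y1 : R) :
  continuous (fun p : R * R => f p.1 p.2) ->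
  (forall x y, exists i, f x y = a i * x + b i * y + e i) ->
  exists i, f x0 y0 <= a i * x0 + b i * y0 + e i /\
            a i * x1 + b i * y1 + e i <= f x1 y1.
Proof.
move=> fc fs.
pose g t : R * R := (x0 + t * (x1 - x0), y0 + t * (y1 - y0)).
have gc : continuous g.
  have gk (z w : R) : continuous (fun t : R => z + t * w).
    by move=> t; apply: cvgD; [exact: cvg_cst|apply: cvgM; [exact: cvg_id|exact: cvg_cst]].
  by move=> t; exact: cvg_pair (gk _ _ t) (gk _ _ t).
have hc : continuous (fun t => f (g t).1 (g t).2).
  by move=> t; apply: (@continuous_comp _ _ _ g (fun p : R * R => f p.1 p.2)); [exact: gc|exact: fc].
have hs t : exists i, f (g t).1 (g t).2 =
    (a i * (x1 - x0) + b i * (y1 - y0)) * t + (a i * x0 + b i * y0 + e i).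
  by have [i ->] := fs (g t).1 (g t).2; exists i; rewrite /g /=; ring.
have [i [h0 h1]] := affine_selection_line hc hs.
exists i; move: h0 h1; rewrite /g /= !mul0r !mul1r !addr0.
rewrite ![_ + (_ - _)]addrC !subrK => h0 h1; split => //.
by apply: le_trans h1; rewrite le_eqVlt; apply/orP; left; apply/eqP; ring.
Qed.

(* The max-min (lattice) representation of a continuous piecewise affine
   function, f = max_{S | chi S} min_{i in S} l_i, split into its two halves. *)
Lemma cpwl_lattice (K : nat) (f : R -> R -> R) (a b e : 'I_K -> R) :
  continuous (fun p : R * R => f p.1 p.2) ->
  (forall x y, exists i, f x y = a i * x + b i * y + e i) ->
  exists chi : {set 'I_K} -> bool,
    (forall x y, exists S, chi S /\
       forall i, i \in S -> f x y <= a i * x + b i * y + e i) /\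
    (forall x y S, chi S -> exists i, i \in S /\
       a i * x + b i * y + e i <= f x y).
Proof.
move=> fc fs.
(* The admissible sets consist of the pieces lying above f at some base point. The first half takes
   the point itself as base; the second compares it with any base point along the segment joining
   them. *)
pose above x y : {set 'I_K} := [set i | f x y <= a i * x + b i * y + e i]%SET.
exists (fun S => `[< exists p : R * R, S = above p.1 p.2 >]); split.
  move=> x y; exists (above x y); split; first by apply/asboolP; exists (x, y).
  by move=> i; rewrite inE.
move=> x y S /asboolP[[x0 y0] ->] /=.
have [i [h0 h1]] := affine_selection_plane x0 y0 x y fc fs.
by exists i; rewrite inE.
Qed.

End Lattice.

(** * A calculus of ReLU networks *)

Section Realization.
Variable R : realType.
Implicit Types D I J S T : finType.

Definition coef_bounded I J (B : R) (A : I -> J -> R) (b : I -> R) : Prop :=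
  (forall i j, `|A i j| <= B) /\ (forall i, `|b i| <= B).

(* L counts the hidden layers, so that L = 0 means an affine map, and W and B bound
   the layer widths and the weights.  Indexing layers by arbitrary finite types lets
   networks be put side by side by means of sum types. *)
Fixpoint net_rep D (W : nat) (B : R) (L : nat) {struct L} :
    forall I, ((D -> R) -> I -> R) -> Prop := fun I p =>
  if L is L'.+1 then
    exists (J : finType) (h : (D -> R) -> J -> R) (A : I -> J -> R) (b : I -> R),
      [/\ (#|J| <= W)%N, net_rep W B L' h, coef_bounded B A b &
          forall x i, p x i = \sum_j A i j * Num.max (h x j) 0 + b i]
  else exists (A : I -> D -> R) (b : I -> R),
    coef_bounded B A b /\ forall x i, p x i = \sum_j A i j * x j + b i.

Lemma relu_sub (t : R) : Num.max t 0 - Num.max (- t) 0 = t.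
Proof.
have [t0|t0] := orP (le_total 0 t).
  by rewrite max_l // max_r ?subr0 // oppr_le0.
by rewrite max_r // max_l ?oppr_ge0 // sub0r opprK.
Qed.

(** Output rows may be repeated, dropped or multiplied by factors of modulus at most 1 without
    raising the weight bound. The interface layer of a composition needs this with signs. *)
Lemma net_rep_reindex D W B L I J (p : (D -> R) -> I -> R) (q : (D -> R) -> J -> R)
    (s : J -> I) (eps : J -> R) :
  (forall j, `|eps j| <= 1) -> (forall x j, q x j = eps j * p x (s j)) ->
  net_rep W B L p -> net_rep W B L q.
Proof.
move=> eps1 qE.
have bd (t : R) j : `|t| <= B -> `|eps j * t| <= B.
  by move=> tB; rewrite normrM -[B]mul1r ler_pM.
case: L => [[A [b [[AB bB] pE]]]|L [K [h [A [b [KW hr [AB bB] pE]]]]]].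
  exists (fun j k => eps j * A (s j) k), (fun j => eps j * b (s j)).
  split; first by split=> *; apply: bd.
  move=> x j; rewrite qE pE mulrDr mulr_sumr; congr (_ + _).
  by apply: eq_bigr => k _; rewrite mulrA.
exists K, h, (fun j k => eps j * A (s j) k), (fun j => eps j * b (s j)).
split=> //; first by split=> *; apply: bd.
move=> x j; rewrite qE pE mulrDr mulr_sumr; congr (_ + _).
by apply: eq_bigr => k _; rewrite mulrA.
Qed.

Lemma net_rep_ext D W B L I (p q : (D -> R) -> I -> R) :
  (forall x i, p x i = q x i) -> net_rep W B L p -> net_rep W B L q.
Proof.
move=> pq; apply: (net_rep_reindex (s := id) (eps := fun=> 1)) => [j|x j].
  by rewrite normr1.
by rewrite mul1r pq.
Qed.

Lemma net_rep_widen D W W' B L I (p : (D -> R) -> I -> R) :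
  (W <= W')%N -> net_rep W B L p -> net_rep W' B L p.
Proof.
move=> WW'; elim: L I p => // L IH I p [J [h [A [b [JW hr AB pE]]]]].
by exists J, h, A, b; split=> //; [exact: leq_trans WW'|exact: IH].
Qed.

Lemma normr_delta I (i j : I) : `|(i == j)%:R : R| <= 1.
Proof. by case: eqP; rewrite ?normr1 ?normr0. Qed.

Lemma sum_delta I (i : I) (F : I -> R) : \sum_j (i == j)%:R * F j = F i.
Proof.
rewrite (bigD1 i) //= eqxx mul1r big1 ?addr0 // => j.
by rewrite eq_sym => /negbTE ->; rewrite mul0r.
Qed.

Lemma net_rep_relu D W B L I (p : (D -> R) -> I -> R) : 1 <= B ->
  (#|I| <= W)%N -> net_rep W B L p ->
  net_rep W B L.+1 (fun x i => Num.max (p x i) 0).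
Proof.
move=> B1 IW pr; exists I, p, (fun i j => (i == j)%:R), (fun=> 0); split=> //.
  split=> *; last by rewrite normr0 (le_trans ler01).
  by apply: le_trans B1; exact: normr_delta.
by move=> x i; rewrite sum_delta addr0.
Qed.

(* The interface layer p = relu p - relu (- p) has weights 0 and +-1 only, so
   that composing networks does not increase the bound B on the weights. *)
Lemma net_rep_comp D S T W B L1 L2 (f : (D -> R) -> S -> R) (g : (S -> R) -> T -> R) :
  (#|S| + #|S| <= W)%N -> net_rep W B L1 f -> net_rep W B L2 g ->
  net_rep W B (L2 + L1.+1) (fun x => g (f x)).
Proof.
move=> SW fr; elim: L2 T g => [T g [A [b [[AB bB] gE]]]|L2 IH T g]; last first.
  move=> [J [h [A [b [JW hr AB gE]]]]].
  by exists J, (fun x => h (f x)), A, b; split=> //; exact: IH.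
pose h x (j : S + S) := match j with inl s => f x s | inr s => - f x s end.
pose A' t (j : S + S) := match j with inl s => A t s | inr s => - A t s end.
exists (S + S)%type, h, A', b; split.
- by rewrite card_sum.
- apply: (net_rep_reindex (s := fun j => match j with inl s => s | inr s => s end)
    (eps := fun j => if j is inl _ then 1 else -1)) fr.
  + by case=> s; rewrite ?normrN normr1.
  + by move=> x [] s; rewrite /h ?mul1r ?mulN1r.
- by split=> // t [] s /=; rewrite ?normrN.
move=> x t; rewrite gE big_sumType /= -big_split /=; congr (_ + _).
by apply: eq_bigr => s _; rewrite -{1}(relu_sub (f x s)) mulrBr mulNr.
Qed.

Lemma net_rep_id D W B : 1 <= B -> net_rep W B 0 (fun x : D -> R => x).
Proof.
move=> B1; exists (fun i j => (i == j)%:R), (fun=> 0); split; last first.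
  by move=> x i; rewrite sum_delta addr0.
split=> *; last by rewrite normr0 (le_trans ler01).
by apply: le_trans B1; exact: normr_delta.
Qed.

(** Composing with the affine identity adds exactly one hidden layer. *)
Lemma net_rep_deepen D W B L L' I (p : (D -> R) -> I -> R) : 1 <= B ->
  (#|I| + #|I| <= W)%N -> (L <= L')%N -> net_rep W B L p -> net_rep W B L' p.
Proof.
move=> B1 IW LL' pr; rewrite -(subnKC LL').
elim: (L' - L)%N => [|k IH]; first by rewrite addn0.
rewrite addnS.
exact: (net_rep_comp IW IH (net_rep_id I W B1)).
Qed.

Lemma net_rep_pair D W1 W2 B L I1 I2 (p1 : (D -> R) -> I1 -> R)
    (p2 : (D -> R) -> I2 -> R) : 0 <= B ->
  net_rep W1 B L p1 -> net_rep W2 B L p2 ->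
  net_rep (W1 + W2) B L
    (fun x (i : I1 + I2) => match i with inl i1 => p1 x i1 | inr i2 => p2 x i2 end).
Proof.
move=> B0; elim: L I1 I2 p1 p2 => [|L IH] I1 I2 p1 p2.
  move=> [A1 [b1 [[A1B b1B] p1E]]] [A2 [b2 [[A2B b2B] p2E]]].
  exists (fun i : I1 + I2 => match i with inl i1 => A1 i1 | inr i2 => A2 i2 end),
    (fun i => match i with inl i1 => b1 i1 | inr i2 => b2 i2 end).
  by split; [split; case|move=> x []].
move=> [J1 [h1 [A1 [b1 [J1W h1r [A1B b1B] p1E]]]]].
move=> [J2 [h2 [A2 [b2 [J2W h2r [A2B b2B] p2E]]]]].
exists (J1 + J2)%type, (fun x (i : J1 + J2) => match i with inl i1 => h1 x i1 | inr i2 => h2 x i2 end),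
  (fun (i : I1 + I2) (j : J1 + J2) => match i, j with
    | inl i1, inl j1 => A1 i1 j1 | inr i2, inr j2 => A2 i2 j2 | _, _ => 0 end),
  (fun i => match i with inl i1 => b1 i1 | inr i2 => b2 i2 end).
split.
- by rewrite card_sum leq_add.
- exact: IH.
- by split=> [[i|i] [j|j]|[i|i]] //; rewrite normr0.
move=> x [i|i]; rewrite big_sumType /= ?p1E ?p2E; congr (_ + _).
  by rewrite [X in _ + X]big1 ?addr0 // => j _; rewrite mul0r.
by rewrite [X in X + _]big1 ?add0r // => j _; rewrite mul0r.
Qed.

(** The initial map has no hidden layer; each step costs its own L layers and one interface
    layer. *)
Lemma net_rep_iter S D W B L (init : (D -> R) -> S -> R) (step : (S -> R) -> S -> R) n :
  (#|S| + #|S| <= W)%N -> net_rep W B 0 init -> net_rep W B L step ->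
  net_rep W B (L.+1 * n) (fun x => iter n step (init x)).
Proof.
move=> SW ir sr; elim: n => [|n IH]; first by rewrite muln0.
rewrite mulnS addSn -addnS /=.
exact: (net_rep_comp SW IH sr).
Qed.

End Realization.

(** * Embedding a layer into one of exactly W neurons *)

Section Padding.
Variables (R : realType) (W : nat) (J : finType).
Hypothesis JW : (#|J| <= W)%N.

Let emb (j : J) : 'I_W := widen_ord JW (enum_rank j).

Let emb_inj : injective emb.
Proof. by move=> i j /(congr1 val) /= /ord_inj /enum_rank_inj. Qed.

(** Neurons outside the image of [emb] carry 0, which sums, products and ReLU preserve, so padding
    commutes with evaluation. *)
Definition pad (F : J -> R) (k : 'I_W) : R :=
  if [pick j | emb j == k] is Some j then F j else 0.

Lemma sum_pad (F : J -> R) : \sum_k pad F k = \sum_j F j.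
Proof.
rewrite [RHS](partition_big emb predT) //=; apply: eq_bigr => k _.
rewrite /pad; case: pickP => [j /eqP jk|no].
  by rewrite (big_pred1 j) // => i; rewrite -jk (inj_eq emb_inj).
by rewrite big_pred0.
Qed.

Lemma padM (F G : J -> R) k : pad F k * pad G k = pad (fun j => F j * G j) k.
Proof. by rewrite /pad; case: pickP => [//|_]; rewrite mulr0. Qed.

Lemma pad_relu (F : J -> R) k : Num.max (pad F k) 0 = pad (fun j => Num.max (F j) 0) k.
Proof. by rewrite /pad; case: pickP => [//|_]; rewrite maxxx. Qed.

Lemma padD (F G : J -> R) k : pad F k + pad G k = pad (fun j => F j + G j) k.
Proof. by rewrite /pad; case: pickP => [//|_]; rewrite addr0. Qed.

Lemma pad_ext (F G : J -> R) k : (forall j, F j = G j) -> pad F k = pad G k.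
Proof. by move=> FG; rewrite /pad; case: pickP. Qed.

Lemma sum_mul_pad (I : finType) (c : I -> R) (F : I -> J -> R) k :
  \sum_i pad (F i) k * c i = pad (fun j => \sum_i F i j * c i) k.
Proof.
rewrite /pad; case: pickP => [//|_]; rewrite big1 // => i _; exact: mul0r.
Qed.

Lemma normr_pad B (F : J -> R) k : 0 <= B -> (forall j, `|F j| <= B) -> `|pad F k| <= B.
Proof. by move=> B0 FB; rewrite /pad; case: pickP => [//|_]; rewrite normr0. Qed.

End Padding.

(** * From abstract representations to matrix networks *)

Section Conversion.
Variable R : realType.

(** Here [h] is the preactivation of one further hidden layer. This makes L + 1 layers: the first is
    the input layer, the other L form [hid]. *)
Lemma net_rep_hidden d W (B : R) L (J : finType) (h : ('I_d -> R) -> J -> R)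
    (JW : (#|J| <= W)%N) : 0 <= B -> net_rep W B L h ->
  exists (A0 : 'M[R]_(W, d)) (b0 : 'cV[R]_W) (hid : seq ('M[R]_W * 'cV[R]_W)),
    [/\ size hid = L, mx_bounded A0 B, mx_bounded b0 B,
        forall p, p \in hid -> mx_bounded p.1 B /\ mx_bounded p.2 B &
        forall x : 'cV[R]_d,
          foldl (fun u p => relu_vec (p.1 *m u + p.2)) (relu_vec (A0 *m x + b0)) hid
          = \col_k pad JW (fun j => Num.max (h (x^~ ord0) j) 0) k].
Proof.
move=> B0; elim: L J h JW => [|L IH] J h JW.
  move=> [A [b [[AB bB] hE]]].
  exists (\matrix_(k, i) pad JW (A^~ i) k), (\col_k pad JW b k), [::]; split=> //.
  - by move=> k i; rewrite mxE normr_pad.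
  - by move=> k i; rewrite mxE normr_pad.
  move=> x; apply/colP => k; rewrite !mxE.
  under eq_bigr do rewrite mxE.
  rewrite sum_mul_pad padD pad_relu.
  by apply: pad_ext => j; rewrite hE.
move=> [J' [h' [A [b [J'W h'r [AB bB] hE]]]]].
have [A0 [b0 [hid [sz A0B b0B hidB ev]]]] := IH _ _ J'W h'r.
pose M : 'M[R]_W := \matrix_(k, k') pad JW (fun j => pad J'W (A j) k') k.
pose v : 'cV[R]_W := \col_k pad JW b k.
exists A0, b0, (rcons hid (M, v)); split=> //.
- by rewrite size_rcons sz.
- move=> p; rewrite mem_rcons inE => /orP[/eqP -> /=|]; last exact: hidB.
  by split=> k i; rewrite mxE normr_pad // => j; rewrite normr_pad.
move=> x; rewrite foldl_rcons ev; apply/colP => k; rewrite !mxE /=.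
under eq_bigr do rewrite !mxE.
rewrite sum_mul_pad padD pad_relu; apply: pad_ext => j.
rewrite hE; congr (Num.max (_ + _) 0).
under eq_bigr do rewrite padM.
by rewrite sum_pad.
Qed.

Lemma net_rep_Upsilon d W (B : R) L N (p : ('I_d -> R) -> 'I_N -> R) :
  0 <= B -> net_rep W B L.+1 p ->
  Upsilon_bounded W L.+1 d N B (fun x => \col_i p (x^~ ord0) i).
Proof.
move=> B0 [J [h [A [b [JW hr [AB bB] pE]]]]].
have [A0 [b0 [hid [sz A0B b0B hidB ev]]]] := net_rep_hidden JW B0 hr.
exists (ReluNet A0 b0 hid (\matrix_(i, k) pad JW (A i) k) (\col_i b i)); split.
- by rewrite /rn_depth sz.
- by split=> // i k; rewrite mxE // normr_pad.
apply/funext => x; rewrite /rn_eval /= ev; apply/colP => i; rewrite !mxE pE.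
under [in RHS]eq_bigr do rewrite !mxE padM.
by rewrite sum_pad.
Qed.

End Conversion.

(** * Families of networks with common width and depth *)

Section Uniform.
Variables (R : realType) (Theta : Type) (B : Theta -> R).
Hypothesis B1 : forall th, 1 <= B th.
Implicit Types D I J S T : finType.

(** Width and depth are chosen before the parameter, while weights may grow with it up to [B th].
    This order of quantifiers keeps the step network independent of n. *)
Definition uniform_rep D I (f : Theta -> (D -> R) -> I -> R) :=
  exists W L, forall th, net_rep W (B th) L (f th).

Definition uniform_rep1 D (f : Theta -> (D -> R) -> R) :=
  uniform_rep (fun th x (_ : unit) => f th x).

Lemma uniform_rep_ext D I (f g : Theta -> (D -> R) -> I -> R) :
  (forall th x i, f th x i = g th x i) -> uniform_rep f -> uniform_rep g.
Proof.
by move=> fg [W [L H]]; exists W, L => th; apply: net_rep_ext (H th).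
Qed.

Lemma uniform_rep_comp D S T (f : Theta -> (D -> R) -> S -> R) (g : Theta -> (S -> R) -> T -> R) :
  uniform_rep f -> uniform_rep g -> uniform_rep (fun th x => g th (f th x)).
Proof.
move=> [W1 [L1 H1]] [W2 [L2 H2]].
exists (W1 + W2 + (#|S| + #|S|))%N, (L2 + L1.+1)%N => th.
apply: net_rep_comp; first exact: leq_addl.
- by apply: net_rep_widen (H1 th); rewrite -addnA leq_addr.
- by apply: net_rep_widen (H2 th); rewrite addnAC leq_addl.
Qed.

Lemma uniform_rep_affine D I (A : Theta -> I -> D -> R) (b : Theta -> I -> R) :
  (forall th, coef_bounded (B th) (A th) (b th)) ->
  uniform_rep (fun th x i => \sum_j A th i j * x j + b th i).
Proof. by move=> AB; exists 0%N, 0%N => th; exists (A th), (b th). Qed.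

Lemma uniform_rep_pair D I J (f : Theta -> (D -> R) -> I -> R) (g : Theta -> (D -> R) -> J -> R) :
  uniform_rep f -> uniform_rep g ->
  uniform_rep (fun th x (i : I + J) => match i with inl i => f th x i | inr j => g th x j end).
Proof.
move=> [W1 [L1 H1]] [W2 [L2 H2]].
exists (W1 + (#|I| + #|I|) + (W2 + (#|J| + #|J|)))%N, (L1 + L2)%N => th.
apply: net_rep_pair; first exact: le_trans ler01 (B1 th).
- apply: (net_rep_deepen (B1 th) _ (leq_addr _ _)); first exact: leq_addl.
  by apply: net_rep_widen (H1 th); exact: leq_addr.
- apply: (net_rep_deepen (B1 th) _ (leq_addl _ _)); first exact: leq_addl.
  by apply: net_rep_widen (H2 th); exact: leq_addr.
Qed.

Lemma uniform_rep_reindex D I J (s : J -> I) (f : Theta -> (D -> R) -> I -> R) :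
  uniform_rep f -> uniform_rep (fun th x j => f th x (s j)).
Proof.
move=> [W [L H]]; exists W, L => th.
apply: (net_rep_reindex (s := s) (eps := fun=> 1)) (H th) => [j|x j].
  by rewrite normr1.
by rewrite mul1r.
Qed.

Lemma uniform_rep_zero D I : uniform_rep (fun _ (_ : D -> R) (_ : I) => 0).
Proof.
apply: (@uniform_rep_ext _ _ (fun th x i => \sum_j 0 * x j + 0)).
  by move=> th x i; rewrite big1 ?addr0 // => j _; rewrite mul0r.
apply: (@uniform_rep_affine _ _ (fun _ _ _ => 0) (fun _ _ => 0)) => th.
by split=> *; rewrite normr0 (le_trans ler01 (B1 th)).
Qed.

Lemma uniform_rep_vec D I (f : Theta -> (D -> R) -> I -> R) :
  (forall i, uniform_rep1 (fun th x => f th x i)) -> uniform_rep f.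
Proof.
move=> fi.
(* Coordinates are adjoined one at a time; those not yet treated output 0. *)
suff H (s : seq I) : uniform_rep (fun th x i => if i \in s then f th x i else 0).
  by apply: uniform_rep_ext (H (enum I)) => th x i; rewrite mem_enum.
elim: s => [|i0 s IH]; first exact: uniform_rep_zero.
have := uniform_rep_reindex (fun i => if i == i0 then inl tt else inr i)
  (uniform_rep_pair (fi i0) IH).
by apply: uniform_rep_ext => th x i; rewrite inE; case: eqP => [->|].
Qed.

Lemma sum_unit (F : unit -> R) : \sum_i F i = F tt.
Proof. by rewrite (big_pred1 tt) // => -[]. Qed.

Lemma uniform_rep1_const D (k : Theta -> R) :
  (forall th, `|k th| <= B th) -> uniform_rep1 (fun th (_ : D -> R) => k th).
Proof.
move=> kB; apply: (@uniform_rep_ext _ _ (fun th x i => \sum_j 0 * x j + k th)).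
  by move=> th x i; rewrite big1 ?add0r // => j _; rewrite mul0r.
apply: (@uniform_rep_affine _ _ (fun _ _ _ => 0) (fun th _ => k th)) => th.
by split=> * //; rewrite normr0 (le_trans ler01 (B1 th)).
Qed.

Lemma uniform_rep1_var D (d : D) : uniform_rep1 (fun _ x => x d).
Proof.
by exists 0%N, 0%N => th; apply: (net_rep_reindex (s := fun=> d) (eps := fun=> 1))
  (net_rep_id D 0 (B1 th)) => *; rewrite ?normr1 ?mul1r.
Qed.

Lemma uniform_rep1_scale D (k : Theta -> R) (f : Theta -> (D -> R) -> R) :
  (forall th, `|k th| <= B th) -> uniform_rep1 f -> uniform_rep1 (fun th x => k th * f th x).
Proof.
move=> kB fr; have kr : uniform_rep (fun th (x : unit -> R) (_ : unit) => \sum_j k th * x j + 0).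
  apply: (@uniform_rep_affine _ _ (fun th _ _ => k th) (fun _ _ => 0)) => th.
  by split=> * //; rewrite normr0 (le_trans ler01 (B1 th)).
apply: uniform_rep_ext (uniform_rep_comp fr kr) => th x i.
by rewrite sum_unit addr0.
Qed.

Lemma uniform_rep1D D (f g : Theta -> (D -> R) -> R) :
  uniform_rep1 f -> uniform_rep1 g -> uniform_rep1 (fun th x => f th x + g th x).
Proof.
move=> fr gr; have kr : uniform_rep (fun th (x : unit + unit -> R) (_ : unit) => \sum_j 1 * x j + 0).
  apply: (@uniform_rep_affine _ _ (fun _ _ _ => 1) (fun _ _ => 0)) => th.
  by split=> *; rewrite ?normr1 ?normr0 // (le_trans ler01 (B1 th)).
apply: uniform_rep_ext (uniform_rep_comp (uniform_rep_pair fr gr) kr) => th x i.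
by rewrite big_sumType !sum_unit !mul1r addr0.
Qed.

Lemma uniform_rep1N D (f : Theta -> (D -> R) -> R) :
  uniform_rep1 f -> uniform_rep1 (fun th x => - f th x).
Proof.
move=> fr; apply: uniform_rep_ext (uniform_rep1_scale (k := fun=> -1) _ fr).
  by move=> th x i; rewrite mulN1r.
by move=> th; rewrite normrN1.
Qed.

Lemma uniform_rep1B D (f g : Theta -> (D -> R) -> R) :
  uniform_rep1 f -> uniform_rep1 g -> uniform_rep1 (fun th x => f th x - g th x).
Proof. by move=> fr gr; apply: uniform_rep1D => //; exact: uniform_rep1N. Qed.

Lemma uniform_rep1_relu D (f : Theta -> (D -> R) -> R) :
  uniform_rep1 f -> uniform_rep1 (fun th x => Num.max (f th x) 0).
Proof.
move=> [W [L H]]; exists (W + #|{: unit}|)%N, L.+1 => th.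
apply: net_rep_relu => //; first exact: leq_addl.
by apply: net_rep_widen (H th); exact: leq_addr.
Qed.

Lemma uniform_rep1_max D (f g : Theta -> (D -> R) -> R) :
  uniform_rep1 f -> uniform_rep1 g -> uniform_rep1 (fun th x => Num.max (f th x) (g th x)).
Proof.
move=> fr gr.
apply: uniform_rep_ext (uniform_rep1D gr (uniform_rep1_relu (uniform_rep1B fr gr))).
by move=> th x _ /=; rewrite addrC addr_maxl subrK add0r.
Qed.

Lemma uniform_rep1_min D (f g : Theta -> (D -> R) -> R) :
  uniform_rep1 f -> uniform_rep1 g -> uniform_rep1 (fun th x => Num.min (f th x) (g th x)).
Proof.
move=> fr gr.
apply: uniform_rep_ext (uniform_rep1N (uniform_rep1_max (uniform_rep1N fr) (uniform_rep1N gr))).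
by move=> th x _ /=; rewrite oppr_max !opprK.
Qed.

Lemma uniform_rep1_big D I (op : R -> R -> R) (idx : Theta -> (D -> R) -> R) (P : pred I)
    (f : I -> Theta -> (D -> R) -> R) :
  (forall g h : Theta -> (D -> R) -> R, uniform_rep1 g -> uniform_rep1 h ->
     uniform_rep1 (fun th x => op (g th x) (h th x))) ->
  uniform_rep1 idx -> (forall i, uniform_rep1 (f i)) ->
  uniform_rep1 (fun th x => \big[op/idx th x]_(i | P i) f i th x).
Proof.
move=> opr ir fr; elim: (index_enum I) => [|i s IH].
  by apply: uniform_rep_ext ir => th x _; rewrite big_nil.
case Pi : (P i).
  by apply: uniform_rep_ext (opr _ _ (fr i) IH) => th x _; rewrite big_cons Pi.
by apply: uniform_rep_ext IH => th x _; rewrite big_cons Pi.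
Qed.

Lemma uniform_rep1_sum D I (f : I -> Theta -> (D -> R) -> R) :
  (forall i, uniform_rep1 (f i)) -> uniform_rep1 (fun th x => \sum_i f i th x).
Proof.
move=> fr; apply: uniform_rep1_big => //; first exact: uniform_rep1D.
by apply: uniform_rep1_const => th; rewrite normr0 (le_trans ler01 (B1 th)).
Qed.

End Uniform.

(** * The cascade network *)

Section Cascade.
Variables (R : realType) (N K : nat).
Implicit Types (B t v P X Y s : R) (e : {ffun bool -> bool}).

(* The data of the cascade network.  The digit e = (e false, e true) selects the
   matrix cd_T e; the affine pieces and the family cd_chi describe the atom in
   max-min form, and cd_B is a single large constant which serves as ramp slope,
   as clipping level and as bound on all weights. *)
Record cascade_data := CascadeData {
  cd_T : {ffun bool -> bool} -> 'I_N -> 'I_N -> R;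
  cd_a : 'I_K -> R;
  cd_b : 'I_K -> R;
  cd_e : 'I_K -> R;
  cd_chi : {set 'I_K} -> bool;
  cd_B : R;
  cd_B2 : 2 <= cd_B;
  cd_TB : forall e q q', `|cd_T e q q'| <= cd_B;
  cd_aB : forall i, `|cd_a i| <= cd_B;
  cd_bB : forall i, `|cd_b i| <= cd_B;
  cd_eB : forall i, `|cd_e i| <= cd_B }.

(** A ramp of slope B from 0 to 1 centred at 1/2; it is a genuine binary digit at distance at least
    1/(2B) from 1/2. *)
Definition digit B t : R :=
  Num.max (B * (t - 2^-1) + 2^-1) 0 - Num.max (B * (t - 2^-1) - 2^-1) 0.

(* At least 1 where [digit] is not a genuine binary digit. *)
Definition ambiguity B t : R :=
  Num.max (2 - B * (2 * Num.max (t - 2^-1) (2^-1 - t))) 0.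

(* For |v| <= B this is v if t = 1, and 0 if t <= 0. *)
Definition gate B v t : R :=
  Num.max (v + B * (t - 1)) 0 - Num.max (- v + B * (t - 1)) 0.

(* Coordinates of the state: [inl (Some k)] is the k-th coordinate of the current
   point x, [inl None] the flag, [inr (None, (q, q'))] the entry of the product P of
   the matrices selected so far, [inr (Some k, (q, q'))] that entry times x k. *)
Definition state := (option bool + option bool * ('I_N * 'I_N))%type.

Implicit Types st : state -> R.

Definition st_pos st (k : bool) : R := st (inl (Some k)).
Definition st_flag st : R := st (inl None).
Definition st_prod st (m : option bool) (q q' : 'I_N) : R := st (inr (m, (q, q'))).

(** The number of coordinates where e agrees with the digits, minus 1. For genuine digits this is 1
    at the right e and at most 0 elsewhere, as [gate] requires. *)
Definition select B e st : R :=
  \sum_k (if e k then digit B (st_pos st k) else 1 - digit B (st_pos st k)) - 1.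

(** The values P and P (2 x_k - e_k) that would follow from the digit e, before multiplication by
    its matrix on the right. *)
Definition branch e st (m : option bool) (q q' : 'I_N) : R :=
  if m is Some k then 2 * st_prod st m q q' - (e k)%:R * st_prod st None q q'
  else st_prod st None q q'.

Definition cascade_step (cd : cascade_data) st : state -> R := fun i =>
  match i with
  | inl (Some k) => 2 * st_pos st k - digit (cd_B cd) (st_pos st k)
  | inl None => st_flag st + \sum_k ambiguity (cd_B cd) (st_pos st k)
  | inr (m, (q, q')) =>
      \sum_e \sum_r cd_T cd e r q' *
        gate (cd_B cd) (branch e st m q r) (select (cd_B cd) e st)
  end.

(** Zero when P has the wrong sign or the flag has reached 1. For P >= 0 and s = 0 it is min(B P,
    B), which lies above P H(x) once H(x) and P H(x) are at most B. *)
Definition cap B P s : R := Num.min (B * Num.max P 0) (Num.max (B * (1 - s)) 0).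

(** The lattice formula homogenised by X = P x and Y = P y: each affine form becomes P times a
    piece. The default 0 of the maximum is harmless because H is nonnegative. *)
Definition max_min (cd : cascade_data) P X Y s : R :=
  \big[Num.max/0]_(S : {set 'I_K}) ((cd_chi cd S)%:R *
    \big[Num.min/cap (cd_B cd) P s]_(i in S)
       (cd_a cd i * X + cd_b cd i * Y + cd_e cd i * P)).

(** Only the column [q0] of P matters, as the atom lives on a single patch. At most one of the two
    terms is nonzero, according to the sign of P. *)
Definition cascade_out (q0 : 'I_N) (cd : cascade_data) st (q : 'I_N) : R :=
  let P := st_prod st None q q0 in
  let X := st_prod st (Some false) q q0 in
  let Y := st_prod st (Some true) q q0 in
  max_min cd P X Y (st_flag st) - max_min cd (- P) (- X) (- Y) (st_flag st).

Let B1 (cd : cascade_data) : 1 <= cd_B cd.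
Proof. by apply: le_trans (cd_B2 cd); rewrite ler1n. Qed.

Lemma normr_bool_le cd (b : bool) : `|b%:R : R| <= cd_B cd.
Proof. by apply: le_trans (B1 cd); case: b; rewrite ?normr1 ?normr0. Qed.

(** The parameter is the whole record, so width and depth depend on N and K only. *)
Lemma uniform_rep_step : uniform_rep cd_B cascade_step.
Proof.
have c1 : uniform_rep1 cd_B (fun _ (_ : state -> R) => 1).
  by apply: (uniform_rep1_const B1) => cd; rewrite normr1.
have c2 : uniform_rep1 cd_B (fun _ (_ : state -> R) => 2).
  by apply: (uniform_rep1_const B1) => cd; rewrite ger0_norm ?cd_B2.
have ch : uniform_rep1 cd_B (fun _ (_ : state -> R) => 2^-1).
  apply: (uniform_rep1_const B1) => cd; rewrite ger0_norm //.
  by apply: le_trans (B1 cd); rewrite invf_le1 ?ler1n.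
have sB (f : cascade_data -> (state -> R) -> R) :
    uniform_rep1 cd_B f -> uniform_rep1 cd_B (fun cd x => cd_B cd * f cd x).
  apply: (uniform_rep1_scale B1) => cd; rewrite ger0_norm //.
  exact: le_trans (B1 cd).
have s2 (f : cascade_data -> (state -> R) -> R) :
    uniform_rep1 cd_B f -> uniform_rep1 cd_B (fun cd x => 2 * f cd x).
  by apply: (uniform_rep1_scale B1) => cd; rewrite ger0_norm ?cd_B2.
have pv k : uniform_rep1 cd_B (fun _ st => st_pos st k) by exact: uniform_rep1_var.
have fv : uniform_rep1 cd_B (fun _ st => st_flag st) by exact: uniform_rep1_var.
have qv m q q' : uniform_rep1 cd_B (fun _ st => st_prod st m q q') by exact: uniform_rep1_var.
have dr k : uniform_rep1 cd_B (fun cd st => digit (cd_B cd) (st_pos st k)).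
  apply: (uniform_rep1B B1); apply: (uniform_rep1_relu B1).
    by apply: (uniform_rep1D B1) => //; apply: sB; apply: (uniform_rep1B B1).
  by apply: (uniform_rep1B B1) => //; apply: sB; apply: (uniform_rep1B B1).
apply: (uniform_rep_vec B1) => -[[k|]|[m [q q']]] /=.
- by apply: (uniform_rep1B B1) => //; apply: s2.
- apply: (uniform_rep1D B1) => //; apply: (uniform_rep1_sum B1) => k.
  apply: (uniform_rep1_relu B1); apply: (uniform_rep1B B1) => //; apply: sB.
  by apply: s2; apply: (uniform_rep1_max B1); apply: (uniform_rep1B B1).
apply: (uniform_rep1_sum B1) => e; apply: (uniform_rep1_sum B1) => r.
apply: (uniform_rep1_scale B1) => [cd|]; first exact: cd_TB.
have br : uniform_rep1 cd_B (fun cd st => branch e st m q r).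
  case: m => [k|] //=; apply: (uniform_rep1B B1); first exact: s2.
  by apply: (uniform_rep1_scale B1) => [cd|//]; exact: normr_bool_le.
have se : uniform_rep1 cd_B (fun cd st => select (cd_B cd) e st).
  apply: (uniform_rep1B B1) => //; apply: (uniform_rep1_sum B1) => k.
  by case: (e k) => //; apply: (uniform_rep1B B1).
have bs : uniform_rep1 cd_B (fun cd st => cd_B cd * (select (cd_B cd) e st - 1)).
  by apply: sB; apply: (uniform_rep1B B1).
apply: (uniform_rep1B B1); apply: (uniform_rep1_relu B1); apply: (uniform_rep1D B1) => //.
exact: (uniform_rep1N B1).
Qed.

Lemma uniform_rep_max_min (P X Y s : cascade_data -> (state -> R) -> R) :
  uniform_rep1 cd_B P -> uniform_rep1 cd_B X -> uniform_rep1 cd_B Y -> uniform_rep1 cd_B s ->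
  uniform_rep1 cd_B (fun cd st => max_min cd (P cd st) (X cd st) (Y cd st) (s cd st)).
Proof.
move=> Pr Xr Yr sr.
have sB (f : cascade_data -> (state -> R) -> R) :
    uniform_rep1 cd_B f -> uniform_rep1 cd_B (fun cd x => cd_B cd * f cd x).
  apply: (uniform_rep1_scale B1) => cd; rewrite ger0_norm //.
  exact: le_trans (B1 cd).
have c1 : uniform_rep1 cd_B (fun _ (_ : state -> R) => 1).
  by apply: (uniform_rep1_const B1) => cd; rewrite normr1.
have c0 : uniform_rep1 cd_B (fun _ (_ : state -> R) => 0).
  by apply: (uniform_rep1_const B1) => cd; rewrite normr0 (le_trans ler01).
apply: uniform_rep1_big => [g h||S]; [exact: (uniform_rep1_max B1)|exact: c0|].
 apply: (uniform_rep1_scale B1) => [cd|]; first exact: normr_bool_le.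
apply: uniform_rep1_big => [g h||i]; first exact: (uniform_rep1_min B1).
  apply: (uniform_rep1_min B1); first by apply: sB; exact: (uniform_rep1_relu B1 Pr).
  by apply: (uniform_rep1_relu B1); apply: sB; exact: (uniform_rep1B B1 c1 sr).
apply: (uniform_rep1D B1); first apply: (uniform_rep1D B1).
- by apply: (uniform_rep1_scale B1) => // cd; exact: cd_aB.
- by apply: (uniform_rep1_scale B1) => // cd; exact: cd_bB.
- by apply: (uniform_rep1_scale B1) => // cd; exact: cd_eB.
Qed.

Lemma uniform_rep_out q0 : uniform_rep cd_B (cascade_out q0).
Proof.
apply: (uniform_rep_vec B1) => q.
have fv : uniform_rep1 cd_B (fun _ st => st_flag st) by exact: uniform_rep1_var.
have qv m : uniform_rep1 cd_B (fun _ st => st_prod st m q q0) by exact: uniform_rep1_var.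
have nqv m := uniform_rep1N B1 (qv m).
exact: (uniform_rep1B B1 (uniform_rep_max_min (qv _) (qv _) (qv _) fv)
                         (uniform_rep_max_min (nqv _) (nqv _) (nqv _) fv)).
Qed.

End Cascade.

(** * Invariant of the digit recursion and correctness of the output *)

Section Invariant.
Variables (R : realType) (N K : nat) (cd : cascade_data R N K).
Local Notation B := (cd_B cd).

Let B0 : 0 < B.
Proof. by apply: lt_le_trans (cd_B2 cd); rewrite ltr0n. Qed.

Lemma digitE (t : R) : 2^-1 <= B * `|t - 2^-1| -> digit B t = (2^-1 <= t)%R%:R.
Proof.
rewrite /digit; case: (lerP 2^-1 t) => ht h; first by rewrite !max_l /=; lra.
by rewrite !max_r ?subrr /=; lra.
Qed.

Lemma max_sub_norm (t s : R) : Num.max (t - s) (s - t) = `|t - s|.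
Proof.
have [h|h] := orP (le_total s t).
  by rewrite ger0_norm ?subr_ge0 // max_l //; lra.
by rewrite ler0_norm ?subr_le0 // opprB max_r //; lra.
Qed.

Lemma ambiguity_ge0 (t : R) : 0 <= ambiguity B t.
Proof. by rewrite /ambiguity le_max lexx orbT. Qed.

Lemma ambiguity_ge1 (t : R) : B * `|t - 2^-1| < 2^-1 -> 1 <= ambiguity B t.
Proof. by rewrite /ambiguity max_sub_norm le_max => h; apply/orP; left; lra. Qed.

Lemma ambiguity_eq0 (t : R) : 1 <= B * `|t - 2^-1| -> ambiguity B t = 0.
Proof. by rewrite /ambiguity max_sub_norm => h; rewrite max_r //; lra. Qed.

Lemma gate_on (v : R) : gate B v 1 = v.
Proof. by rewrite /gate subrr mulr0 !addr0 relu_sub. Qed.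

Lemma gate_off (v t : R) : `|v| <= B -> t <= 0 -> gate B v t = 0.
Proof.
rewrite ler_norml => /andP[v1 v2] t0.
have : B * (t - 1) <= - B by nra.
by move=> h; rewrite /gate !max_r ?subrr //; lra.
Qed.

Section Step.
Variables (st : state N -> R) (d : {ffun bool -> bool}).
Hypothesis std : forall k, digit B (st_pos st k) = (d k)%:R.

Lemma select_eq : select B d st = 1.
Proof. by rewrite /select big_bool /= !std; case: (d true); case: (d false) => /=; lra. Qed.

Lemma select_neq e : e != d -> select B e st <= 0.
Proof.
move=> ed; rewrite /select big_bool /= !std.
have : (e true != d true) || (e false != d false).
  apply: contraNT ed; rewrite negb_or !negbK => /andP[/eqP e1 /eqP e2].
  by apply/eqP/ffunP => -[].
by case: (e true); case: (d true); case: (e false); case: (d false) => //= _; lra.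
Qed.

(** Only the gate of the true digit d is open. A rejected gate closes only for inputs of modulus at
    most B, so the bound is imposed on every branch. *)
Lemma cascade_step_prod m q q' :
  (forall e r, `|branch e st m q r| <= B) ->
  st_prod (cascade_step cd st) m q q' = \sum_r cd_T cd d r q' * branch d st m q r.
Proof.
move=> brB; rewrite /st_prod /cascade_step (bigD1 d) //= [X in _ + X]big1 ?addr0.
  by apply: eq_bigr => r _; rewrite select_eq gate_on.
move=> e ed; apply: big1 => r _.
by rewrite gate_off ?mulr0 // select_neq.
Qed.

End Step.

(* [F k x] stands for Vec (V^k H) at the point x, and [target] for Vec (V^n H) at
   the input point. *)
Variables (n : nat) (F : nat -> (bool -> R) -> 'I_N -> R) (target : 'I_N -> R).
Variables (rho Q : R).
Hypothesis F_refine : forall k (e : {ffun bool -> bool}) (x x' : bool -> R) q,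
  (forall i, 0 <= x i <= 1) -> (forall i, 0 <= x' i <= 1) ->
  (forall i, x' i = 2 * x i - (e i)%:R) ->
  F k.+1 x q = \sum_r cd_T cd e q r * F k x' r.
Hypothesis F_vanish : forall k i (x : bool -> R) q,
  2 ^+ k.+1 * `|x i - 2^-1| < rho -> F k.+1 x q = 0.
Hypothesis rho_gt0 : 0 < rho.
Hypothesis rhoB : 2 ^+ n <= rho * B.
Hypothesis Q_ge1 : 1 <= Q.
Hypothesis T_sum : forall e r, \sum_q `|cd_T cd e q r| <= Q.
Hypothesis QB : 3 * Q ^+ n <= B.

(** After i correct digits, P applied to the remaining level n - i gives the target. The flag may
    already be positive, but only if the target vanishes. *)
Definition exact_state (i : nat) (st : state N -> R) : Prop :=
  [/\ forall k, 0 <= st_pos st k <= 1,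
      forall q, target q = \sum_r st_prod st None q r * F (n - i) (st_pos st) r,
      forall k q r, st_prod st (Some k) q r = st_pos st k * st_prod st None q r,
      forall q r, `|st_prod st None q r| <= Q ^+ i &
      0 <= st_flag st /\ (st_flag st = 0 \/ forall q, target q = 0)].

(** After a possibly wrong digit nothing is known of the point and of P; a flag of at least 1
    persists and forces the output 0, which is then correct. *)
Definition valid_state (i : nat) (st : state N -> R) : Prop :=
  exact_state i st \/ (1 <= st_flag st /\ forall q, target q = 0).

(** As i < n, at least one level remains. Within 1/B of 1/2, the bound 2^n <= rho B places the point
    in the zone where that level vanishes. *)
Lemma target_vanish i st k : (i < n)%N -> exact_state i st ->
  B * `|st_pos st k - 2^-1| < 1 -> forall q, target q = 0.
Proof.
move=> iltn [_ tE _ _ _] near q; rewrite tE big1 // => r _.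
have [j nij] : exists j, (n - i = j.+1)%N by exists (n - i).-1; lia.
rewrite nij (F_vanish (i := k)) ?mulr0 //.
have jn : (2 : R) ^+ j.+1 <= 2 ^+ n by apply: ler_weXn2l; [rewrite ler1n|lia].
have d0 : 0 <= `|st_pos st k - 2^-1| by [].
apply: (@le_lt_trans _ _ (rho * (B * `|st_pos st k - 2^-1|))).
  by rewrite mulrA; apply: ler_wpM2r => //; exact: le_trans rhoB.
by rewrite -[X in _ < X]mulr1 ltr_pM2l.
Qed.

(** Even for a wrong digit, 2 x_k - e_k stays in [-1, 2], so the factor 3 in the bound on Q^n
    suffices. *)
Lemma branch_le i st e m q r : (i < n)%N -> exact_state i st -> `|branch e st m q r| <= B.
Proof.
move=> iltn [xk _ pE pB _].
have Pn : 3 * `|st_prod st None q r| <= B.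
  apply: le_trans QB; rewrite ler_pM2l ?ltr0n //; apply: le_trans (pB q r) _.
  by apply: ler_weXn2l => //; exact: ltnW.
case: m => [k|] /=; last by apply: le_trans Pn; rewrite ler_peMl ?ler1n.
rewrite pE mulrA -mulrBl normrM; apply: le_trans Pn.
apply: ler_wpM2r => //; have /andP[x0 x1] := xk k.
by rewrite ler_norml; case: (e k) => /=; apply/andP; split; lra.
Qed.

Lemma valid_step i st : (i < n)%N -> valid_state i st -> valid_state i.+1 (cascade_step cd st).
Proof.
move=> iltn.
have flagE : st_flag (cascade_step cd st) = st_flag st + \sum_k ambiguity B (st_pos st k) by [].
have sum0 : 0 <= \sum_k ambiguity B (st_pos st k) by apply: sumr_ge0 => k _; exact: ambiguity_ge0.
case=> [ex|[s1 t0]]; last by right; rewrite flagE; split=> //; lra.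
(* Within 1/(2B) of 1/2 the digit is unreliable: the flag rises by at least 1, and the target is
   0. *)
have [[k near]|far] := pselect (exists k, B * `|st_pos st k - 2^-1| < 2^-1).
  right; split; last by apply: (target_vanish iltn ex (k := k)); lra.
  have [_ _ _ _ [s0 _]] := ex.
  rewrite flagE (bigD1 k) //=; have b1 := ambiguity_ge1 near.
  have : 0 <= \sum_(j | j != k) ambiguity B (st_pos st j) by apply: sumr_ge0 => j _; exact: ambiguity_ge0.
  by lra.
pose d : {ffun bool -> bool} := [ffun k => 2^-1 <= st_pos st k].
have std k : digit B (st_pos st k) = (d k)%:R.
  by rewrite ffunE digitE // leNgt; apply/negP => h; apply: far; exists k.
have prodE m q q' := cascade_step_prod std q' (fun e r => branch_le e m q r iltn ex).
have [xk tE pE pB [s0 s0t]] := ex.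
have posE k : st_pos (cascade_step cd st) k = 2 * st_pos st k - (d k)%:R.
  by rewrite -std.
have pos01 k : 0 <= st_pos (cascade_step cd st) k <= 1.
  rewrite posE ffunE; have /andP[x0 x1] := xk k.
  by case: (lerP 2^-1 (st_pos st k)) => h /=; apply/andP; split; lra.
left; split=> //.
- move=> q; rewrite tE; have -> : (n - i = (n - i.+1).+1)%N by lia.
  under eq_bigr do rewrite (F_refine _ _ xk pos01 posE) mulr_sumr.
  rewrite exchange_big /=; apply: eq_bigr => r _; rewrite prodE mulr_suml.
  by apply: eq_bigr => r' _ /=; ring.
- move=> k q r; rewrite !prodE mulr_sumr; apply: eq_bigr => r' _ /=.
  by rewrite pE posE; ring.
- move=> q r; rewrite prodE; apply: le_trans (ler_norm_sum _ _ _) _ => /=.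
  apply: (@le_trans _ _ (\sum_r' `|cd_T cd d r' r| * Q ^+ i)).
    by apply: ler_sum => r' _; rewrite normrM ler_wpM2l.
  by rewrite -mulr_suml exprS ler_wpM2r // exprn_ge0 // (le_trans ler01).
split; first by rewrite flagE addr_ge0.
case: s0t => [s0'|]; last by right.
(* Between distances 1/(2B) and 1/B the digit is right but the flag may become fractional; the
   target vanishes there, so a partly closed cap does no harm. *)
have [[k near]|far1] := pselect (exists k, B * `|st_pos st k - 2^-1| < 1).
  by right; apply: (target_vanish iltn ex (k := k)).
left; rewrite flagE s0' add0r big1 // => k _; apply: ambiguity_eq0.
by rewrite leNgt; apply/negP => h; apply: far1; exists k.
Qed.

Lemma valid_iter st : valid_state 0 st -> valid_state n (iter n (cascade_step cd) st).
Proof.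
move=> v0; have : (n <= n)%N by []; elim: {1 3 4}n => // i IH iltn /=.
by apply: valid_step => //; apply: IH; exact: ltnW.
Qed.

Lemma cap_nneg P s : 0 <= cap B P s.
Proof.
rewrite /cap le_min le_max lexx orbT andbT.
by apply: mulr_ge0; [exact: ltW|rewrite le_max lexx orbT].
Qed.

Lemma max_min_cap0 P X Y s : cap B P s = 0 -> max_min cd P X Y s = 0.
Proof.
move=> c0; apply/le_anti/andP; split; last exact: bigmax_ge_id.
apply: bigmax_le => // S _; rewrite c0.
have := bigmin_le_id (index_enum 'I_K) 0 (mem S)
  (fun i => cd_a cd i * X + cd_b cd i * Y + cd_e cd i * P).
by case: (cd_chi cd S) => /= h; rewrite ?mul1r ?mul0r.
Qed.

(** A factor P >= 0 can be pulled out of minima and maxima. Every admissible set has a piece below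
    h, and one admissible set has all its pieces above h. *)
Lemma max_min_pos P x y s (h : R) : 0 <= P -> 0 <= h ->
  (exists S, cd_chi cd S /\ forall i, i \in S -> h <= cd_a cd i * x + cd_b cd i * y + cd_e cd i) ->
  (forall S, cd_chi cd S -> exists i, i \in S /\ cd_a cd i * x + cd_b cd i * y + cd_e cd i <= h) ->
  max_min cd P (x * P) (y * P) s = Num.min (cap B P s) (h * P).
Proof.
move=> P0 h0 [S0 [chi0 S0h]] hS.
have lE i : cd_a cd i * (x * P) + cd_b cd i * (y * P) + cd_e cd i * P =
    (cd_a cd i * x + cd_b cd i * y + cd_e cd i) * P by ring.
have m0 : 0 <= Num.min (cap B P s) (h * P) by rewrite le_min cap_nneg mulr_ge0.
apply/le_anti/andP; split.
  apply: bigmax_le => // S _; case chiS : (cd_chi cd S); rewrite /= ?mul0r // mul1r.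
  rewrite le_min bigmin_le_id /=; have [i [iS ih]] := hS S chiS.
  apply: le_trans (bigmin_le_cond _ _ iS) _.
  by rewrite lE; apply: ler_wpM2r.
apply: le_trans (le_bigmax _ _ S0); rewrite chi0 mul1r.
apply: le_bigmin => [|i iS]; first by rewrite ge_min lexx.
by rewrite ge_min lE ler_wpM2r ?orbT ?S0h.
Qed.

Variables (q0 : 'I_N) (h : (bool -> R) -> R) (hmax : R).
Hypothesis F0 : forall (x : bool -> R) q, (forall i, 0 <= x i <= 1) -> F 0 x q = (q0 == q)%:R * h x.
Hypothesis h01 : forall x : bool -> R, (forall i, 0 <= x i <= 1) -> 0 <= h x <= hmax.
Hypothesis hmaxB : hmax * Q ^+ n <= B.
Hypothesis h_lower : forall x, exists S, cd_chi cd S /\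
  forall i, i \in S -> h x <= cd_a cd i * x false + cd_b cd i * x true + cd_e cd i.
Hypothesis h_upper : forall x S, cd_chi cd S -> exists i, i \in S /\
  cd_a cd i * x false + cd_b cd i * x true + cd_e cd i <= h x.

(** A raised flag closes both caps. On an exact state the target is P h(x), and the term with the
    matching sign of P produces it. *)
Lemma cascade_out_valid st q : valid_state n st -> cascade_out q0 cd st q = target q.
Proof.
case=> [[xk tE pE pB [s0 s0t]]|[s1 t0]]; last first.
  have c0 P : cap B P (st_flag st) = 0.
    rewrite /cap [X in Num.min _ X]max_r; last by rewrite pmulr_rle0 // subr_le0.
    by rewrite min_r // mulr_ge0 ?(ltW B0) // le_max lexx orbT.
  by rewrite /cascade_out !max_min_cap0 // subrr t0.
have {}tE : target q = h (st_pos st) * st_prod st None q q0.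
  rewrite tE subnn (bigD1 q0) //= F0 // eqxx mul1r mulrC [X in _ + X]big1 ?addr0 // => r rq.
  by rewrite F0 // eq_sym (negbTE rq) mul0r mulr0.
rewrite /cascade_out !pE tE.
have /andP[hx0 hx1] := h01 xk.
have hQ : h (st_pos st) * `|st_prod st None q q0| <= B.
  by apply: le_trans hmaxB; apply: ler_pM.
have hB : h (st_pos st) <= B.
  apply: le_trans hmaxB; apply: (le_trans hx1); rewrite ler_peMr ?exprn_ege1 //.
  exact: le_trans hx1.
move: tE hQ; set P := st_prod _ _ _ _; set s := st_flag st in s0 s0t *.
set x := st_pos st in hx0 hx1 hB *; move=> tE hQ.
(* On an exact state the cap can be active only if the true value vanishes. *)
have capE P' : 0 <= P' -> `|P'| = `|P| -> Num.min (cap B P' s) (h x * P') = h x * P'.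
  move=> P'0 PP'; apply: min_r; rewrite /cap le_min max_l // ler_wpM2r //=.
  case: s0t => [->|t0].
    by rewrite subr0 mulr1 le_max -(ger0_norm P'0) PP' hQ.
  suff -> : h x * P' = 0 by rewrite le_max lexx orbT.
  apply/eqP; rewrite -normr_eq0 normrM PP' -normrM -tE t0 normr0.
  by [].
have cap0 P' : P' <= 0 -> cap B P' s = 0.
  by move=> P'0; rewrite /cap max_r // mulr0 min_l // le_max lexx orbT.
have [P0|P0] := orP (le_total 0 P).
  rewrite (max_min_pos _ P0 hx0 (h_lower x) (@h_upper x)) capE //.
  by rewrite max_min_cap0 ?subr0 // cap0 // oppr_le0.
rewrite max_min_cap0 ?cap0 // -!mulrN.
rewrite (max_min_pos _ _ hx0 (h_lower x) (@h_upper x)) ?oppr_ge0 // capE ?normrN ?oppr_ge0 //.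
by rewrite mulrN sub0r opprK.
Qed.

End Invariant.

(** * The subdivision operator *)

Section Subdivision.
Variable R : realType.

Lemma sum_int_delta (n : nat) (lo : int) (F : int -> R) (k : int) :
  (~~ (lo <= k < lo + n%:Z) -> F k = 0) ->
  \sum_(i < n) (k == lo + i%:Z)%:R * F (lo + i%:Z) = F k.
Proof.
move=> Fk; case: (boolP (lo <= k < lo + n%:Z)) => [/andP[k0 k1]|out]; last first.
  rewrite Fk // big1 // => i _; case: eqP => [kE|_]; last by rewrite mul0r.
  by move: out; rewrite kE; have := ltn_ord i; lia.
have [m kE] : exists m : nat, k = lo + m%:Z.
  by exists `|k - lo|%N; lia.
have mn : (m < n)%N by lia.
rewrite (bigD1 (Ordinal mn)) //= -kE eqxx mul1r big1 ?addr0 // => i ni.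
case: eqP => [e|_]; last by rewrite mul0r.
case/eqP: ni; apply: val_inj => /=; lia.
Qed.

(** Both sides are the same convolution over the integers, indexed by the range of c or by that of
    g. A Kronecker delta is inserted and the sums exchanged. *)
Lemma sum_conv (M L : nat) (c g : int -> R) (s : int) :
  (forall j, M%:Z < `|j| -> c j = 0) ->
  (forall j, ~~ (0 <= j < L%:Z) -> g j = 0) ->
  \sum_(i < (M + M).+1) c (i%:Z - M%:Z) * g (s - (i%:Z - M%:Z)) =
  \sum_(m < L) c (s - m%:Z) * g m%:Z.
Proof.
move=> cM gL.
transitivity (\sum_(i < (M + M).+1) \sum_(m < L)
    (s - (i%:Z - M%:Z) == m%:Z)%:R * (c (i%:Z - M%:Z) * g m%:Z)).
  apply: eq_bigr => i _.
  rewrite -(@sum_int_delta L 0 g (s - (i%:Z - M%:Z))); last first.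
    by rewrite add0r; exact: gL.
  by rewrite mulr_sumr; apply: eq_bigr => m _; rewrite add0r; ring.
rewrite exchange_big /=; apply: eq_bigr => m _.
rewrite -(@sum_int_delta (M + M).+1 (- M%:Z) c (s - m%:Z)); last first.
  by move=> out; apply: cM; lia.
rewrite mulr_suml; apply: eq_bigr => i _.
have -> : (s - (i%:Z - M%:Z) == m%:Z) = (s - m%:Z == - M%:Z + i%:Z).
  by apply/eqP/eqP; lia.
by rewrite (addrC (- M%:Z)) mulrA.
Qed.

Lemma sum_divn_modn (m n : nat) (F : nat -> nat -> R) : (0 < n)%N ->
  \sum_(q < m * n) F (q %/ n)%N (q %% n)%N = \sum_(i < m) \sum_(j < n) F i j.
Proof.
move=> n0; rewrite -(big_mkord xpredT (fun q => F (q %/ n)%N (q %% n)%N)) big_nat_mul.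
rewrite big_mkord; apply: eq_bigr => i _.
rewrite -{1}[(i * n)%N]add0n mulSn big_addn addnK big_mkord.
apply: eq_bigr => j _.
by rewrite addnC divnMDl // divn_small // addn0 modnMDl modn_small.
Qed.

Variables (M : nat) (c : int -> int -> R) (L1 L2 : nat).
Hypothesis cM : mask_supported M c.
Hypothesis pw : preserves_window M c L1 L2.

(** Strictness matters: for x in [0,1], the closed window would also admit the shifts -1 and [L1],
    which correspond to no patch. *)
Definition open_window (f : R -> R -> R) : Prop :=
  forall x y, f x y != 0 -> 0 < x < L1%:R /\ 0 < y < L2%:R.

Lemma mask_ordinal (j : int) : `|j| <= M%:Z -> exists i : 'I_(M + M).+1, j = i%:Z - M%:Z.
Proof.
move=> jM; have h : (`|(j + M%:Z)%R| < (M + M).+1)%N by lia.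
by exists (Ordinal h) => /=; lia.
Qed.

(* The window condition, tested on the indicator functions of single points. *)
Lemma mask_in_window j k : c j k != 0 -> 0 <= j <= L1%:Z /\ 0 <= k <= L2%:Z.
Proof.
move=> cjk.
have [jM kM] : `|j| <= M%:Z /\ `|k| <= M%:Z.
  by split; rewrite leNgt; apply: contra_neqN cjk => h; apply: cM; rewrite h ?orbT.
have test (p q : R) : 0 <= p <= L1%:R -> 0 <= q <= L2%:R ->
    0 <= p + j%:~R <= 2 * L1%:R /\ 0 <= q + k%:~R <= 2 * L2%:R.
  move=> hp hq.
  pose f (x y : R) : R := ((x == p) && (y == q))%:R.
  have fw : supp_in f 0 L1%:R 0 L2%:R.
    move=> x y; rewrite /f; case: (eqVneq x p) => [->|_]; last by rewrite eqxx.
    by case: (eqVneq y q) => [->|_]; rewrite ?eqxx.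
  (* At this point exactly one term of V sees the indicator of (p, q), so the value is c j k. *)
  have := pw fw (x := (p + j%:~R) / 2) (y := (q + k%:~R) / 2).
  suff -> : Vop M c f ((p + j%:~R) / 2) ((q + k%:~R) / 2) = c j k.
    by move=> /(_ cjk) [h1 h2]; lra.
  have [i0 jE] := mask_ordinal jM; have [l0 kE] := mask_ordinal kM.
  have fE i l : f (2 * ((p + j%:~R) / 2) - (i%:Z - M%:Z)%:~R)
      (2 * ((q + k%:~R) / 2) - (l%:Z - M%:Z)%:~R) = ((i == i0 :> nat) && (l == l0 :> nat))%:R.
    rewrite /f mulrC divfK ?pnatr_eq0 // mulrC divfK ?pnatr_eq0 //.
    rewrite !subr_eq !(inj_eq (addrI _)) !eqr_int jE kE.
    by congr ((_ && _)%:R); apply/eqP/eqP; lia.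
  rewrite /Vop (bigD1 i0) //= [X in _ + X]big1 ?addr0 => [|i ni]; last first.
    apply: big1 => l _; rewrite fE (_ : (i == i0 :> nat) = false) ?mulr0 //.
    exact: negbTE ni.
  rewrite (bigD1 l0) //= [X in _ + X]big1 ?addr0 => [|l nl]; last first.
    by rewrite fE (_ : (l == l0 :> nat) = false) ?andbF ?mulr0 //; exact: negbTE nl.
  by rewrite fE !eqxx mulr1 -jE -kE.
have L10 : 0 <= L1%:R :> R by []. have L20 : 0 <= L2%:R :> R by [].
have z1 : 0 <= (0 : R) <= L1%:R by rewrite lexx.
have z2 : 0 <= (0 : R) <= L2%:R by rewrite lexx.
have t1 : 0 <= (L1%:R : R) <= L1%:R by rewrite lexx andbT.
have t2 : 0 <= (L2%:R : R) <= L2%:R by rewrite lexx andbT.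
(* The corner (0, 0) yields the lower bounds on j and k, the corner (L1, L2) the upper ones. *)
have [/andP[a1 _] /andP[b1 _]] := test _ _ z1 z2.
have [/andP[_ c2] /andP[_ d2]] := test _ _ t1 t2.
have c3 : j%:~R <= (L1%:Z)%:~R :> R by rewrite -pmulrn; lra.
have d3 : k%:~R <= (L2%:Z)%:~R :> R by rewrite -pmulrn; lra.
rewrite add0r ler0z in a1; rewrite add0r ler0z in b1; rewrite !ler_int in c3 d3.
by rewrite a1 b1 c3 d3.
Qed.

Lemma open_window_Vop f : open_window f -> open_window (Vop M c f).
Proof.
move=> fw x y Vf.
have [i [l]] : exists i l : int, c i l != 0 /\ f (2 * x - i%:~R) (2 * y - l%:~R) != 0.
  apply: contrapT => no; case/eqP: Vf; rewrite /Vop big1 // => i _; rewrite big1 // => l _.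
  apply/eqP; apply: contrapT => /negP; rewrite mulf_eq0 negb_or => /andP[h1 h2].
  by apply: no; exists (i%:Z - M%:Z), (l%:Z - M%:Z).
move=> [cil /fw[/andP[x1 x2] /andP[y1 y2]]].
have [/andP[i0 i1] /andP[l0 l1]] := mask_in_window cil.
have i0' : 0 <= i%:~R :> R by rewrite ler0z.
have l0' : 0 <= l%:~R :> R by rewrite ler0z.
have i1' : i%:~R <= L1%:R :> R by rewrite -[X in _ <= X]/(_ *+ _) pmulrn ler_int.
have l1' : l%:~R <= L2%:R :> R by rewrite pmulrn ler_int.
by split; apply/andP; split; lra.
Qed.

Lemma open_window_shift f (x y : R) (j k : int) : open_window f ->
  0 <= x <= 1 -> 0 <= y <= 1 -> f (x + j%:~R) (y + k%:~R) != 0 ->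
  0 <= j < L1%:Z /\ 0 <= k < L2%:Z.
Proof.
move=> fw /andP[x0 x1] /andP[y0 y1] /fw[/andP[h1 h2] /andP[h3 h4]].
have a1 : (-1)%:~R < j%:~R :> R by rewrite mulrN1z; lra.
have a2 : j%:~R < L1%:Z%:~R :> R by rewrite -pmulrn; lra.
have a3 : (-1)%:~R < k%:~R :> R by rewrite mulrN1z; lra.
have a4 : k%:~R < L2%:Z%:~R :> R by rewrite -pmulrn; lra.
by rewrite !ltr_int in a1 a2 a3 a4; split; lia.
Qed.

(** The sum over mask indices becomes a sum over patches by [sum_conv], one variable at a time. *)
Lemma Vop_refine f (x y x' y' : R) (d e : int) (a b : nat) : open_window f ->
  0 <= x' <= 1 -> 0 <= y' <= 1 -> x' = 2 * x - d%:~R -> y' = 2 * y - e%:~R ->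
  Vop M c f (x + a%:R) (y + b%:R) =
  \sum_(m < L1) \sum_(l < L2)
    c (d + 2 * a%:Z - m%:Z) (e + 2 * b%:Z - l%:Z) * f (x' + m%:R) (y' + l%:R).
Proof.
move=> fw hx' hy' x'E y'E.
pose g (j k : int) := f (x' + j%:~R) (y' + k%:~R).
have g1 j k : ~~ (0 <= j < L1%:Z) -> g j k = 0.
  by move=> nj; apply/eqP; apply: contraNT nj => /(open_window_shift fw hx' hy')[].
have g2 j k : ~~ (0 <= k < L2%:Z) -> g j k = 0.
  by move=> nk; apply/eqP; apply: contraNT nk => /(open_window_shift fw hx' hy')[].
have c1 j k : M%:Z < `|j| -> c j k = 0 by move=> h; apply: cM; rewrite h.
have c2 j k : M%:Z < `|k| -> c j k = 0 by move=> h; apply: cM; rewrite h orbT.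
transitivity (\sum_(i < (M + M).+1) \sum_(l < (M + M).+1)
    c (i%:Z - M%:Z) (l%:Z - M%:Z) *
    g (d + 2 * a%:Z - (i%:Z - M%:Z)) (e + 2 * b%:Z - (l%:Z - M%:Z))).
  apply: eq_bigr => i _; apply: eq_bigr => l _; congr (_ * f _ _).
    by rewrite x'E !rmorphB !rmorphD rmorphM /=; ring.
  by rewrite y'E !rmorphB !rmorphD rmorphM /=; ring.
transitivity (\sum_(i < (M + M).+1) \sum_(l < L2)
    c (i%:Z - M%:Z) (e + 2 * b%:Z - l%:Z) * g (d + 2 * a%:Z - (i%:Z - M%:Z)) l%:Z).
  apply: eq_bigr => i _.
  apply: (@sum_conv M L2 (c (i%:Z - M%:Z)) (g (d + 2 * a%:Z - (i%:Z - M%:Z)))) => j.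
    exact: c2.
  exact: g2.
rewrite exchange_big /= [RHS]exchange_big /=; apply: eq_bigr => l _.
apply: (@sum_conv M L1 (c^~ (e + 2 * b%:Z - l%:Z)) (g^~ l%:Z)) => j.
  exact: c1.
exact: g1.
Qed.

(** H vanishes when a coordinate is within rho of an integer, and the substitution z -> 2z - m turns
    closeness at level k + 1 into closeness at level k. *)
Lemma iter_Vop_vanish (H : R -> R -> R) rho k (x y : R) (j : int) :
  supp_in H rho (1 - rho) rho (1 - rho) ->
  `|2 ^+ k * x - j%:~R| < rho \/ `|2 ^+ k * y - j%:~R| < rho ->
  iter k (Vop M c) H x y = 0.
Proof.
move=> Hs; elim: k x y j => [|k IH] x y j /=.
  rewrite expr0 !mul1r => near; apply/eqP; apply: contrapT => /negP/Hs[/andP[x0 x1] /andP[y0 y1]].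
  have [j0 j1] : 0 < j%:~R :> R /\ j%:~R < 1%:~R :> R.
    by rewrite mulr1z; case: near; rewrite ltr_norml => /andP[h1 h2]; split; lra.
  by rewrite ltr0z in j0; rewrite ltr_int in j1; lia.
move=> near; rewrite /Vop big1 // => i _; rewrite big1 // => l _.
have E (z : R) (m : int) : 2 ^+ k * (2 * z - m%:~R) - (j - 2 ^+ k * m)%:~R = 2 ^+ k.+1 * z - j%:~R.
  by rewrite rmorphB rmorphM rmorphXn /= exprS; ring.
case: near => near.
  by rewrite (IH _ _ (j - 2 ^+ k * (i%:Z - M%:Z))) ?mulr0 // E; left.
by rewrite (IH _ _ (j - 2 ^+ k * (l%:Z - M%:Z))) ?mulr0 // E; right.
Qed.

End Subdivision.

(** * Vectorized refinement by the digit matrices *)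

Section Patches.
Variables (R : realType) (M : nat) (c : int -> int -> R) (L1 L2 : nat).
Hypothesis cM : mask_supported M c.
Hypothesis pw : preserves_window M c L1 L2.
Hypothesis L1_gt0 : (0 < L1)%N.
Hypothesis L2_gt0 : (0 < L2)%N.
Local Notation N := (L1 * L2)%N.

Definition patch (f : R -> R -> R) (x : bool -> R) (q : 'I_N) : R :=
  f (x false + (q %/ L2)%:R) (x true + (q %% L2)%:R).

(** The entries of the matrix T_e, with q encoding the patch (q %/ L2, q %% L2). *)
Definition refine_coef (e : {ffun bool -> bool}) (q r : 'I_N) : R :=
  c ((e false : nat)%:Z + 2 * (q %/ L2)%:Z - (r %/ L2)%:Z)
    ((e true : nat)%:Z + 2 * (q %% L2)%:Z - (r %% L2)%:Z).

Lemma patch_refine f (e : {ffun bool -> bool}) (x x' : bool -> R) q : open_window L1 L2 f ->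
  (forall i, 0 <= x' i <= 1) -> (forall i, x' i = 2 * x i - (e i)%:R) ->
  patch (Vop M c f) x q = \sum_r refine_coef e q r * patch f x' r.
Proof.
move=> fw x'01 x'E; rewrite /patch.
rewrite (Vop_refine cM (d := (e false : nat)%:Z) (e := (e true : nat)%:Z)
  _ _ fw (x'01 false) (x'01 true)) -?pmulrn //.
by rewrite -(sum_divn_modn _ (fun m l =>
  c ((e false : nat)%:Z + 2 * (q %/ L2)%:Z - m%:Z) ((e true : nat)%:Z + 2 * (q %% L2)%:Z - l%:Z)
    * f (x' false + m%:R) (x' true + l%:R)) L2_gt0).
Qed.

Lemma open_window_iter H rho k : 0 < rho -> supp_in H rho (1 - rho) rho (1 - rho) ->
  open_window L1 L2 (iter k (Vop M c) H).
Proof.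
move=> rho0 Hs; elim: k => [|k IH]; last exact: open_window_Vop.
move=> x y /Hs[/andP[x0 x1] /andP[y0 y1]].
have l1 : 1 <= L1%:R :> R by rewrite ler1n.
have l2 : 1 <= L2%:R :> R by rewrite ler1n.
by split; apply/andP; split; lra.
Qed.

Lemma patch_vanish H rho k i (x : bool -> R) q : supp_in H rho (1 - rho) rho (1 - rho) ->
  2 ^+ k.+1 * `|x i - 2^-1| < rho -> patch (iter k.+1 (Vop M c) H) x q = 0.
Proof.
move=> Hs near.
(* Since 2^(k+1) times 1/2 is the integer 2^k, closeness to 1/2 becomes closeness to an integer
   after scaling. *)
have E (z : R) (m : nat) : `|2 ^+ k.+1 * (z + m%:R) - ((2 ^ k + 2 ^ k.+1 * m)%N%:Z)%:~R| =
    2 ^+ k.+1 * `|z - 2^-1|.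
  rewrite -[2 ^+ k.+1 in RHS]ger0_norm ?exprn_ge0 // -normrM; congr `|_|.
  by rewrite -pmulrn natrD natrM !natrX exprS; field.
case: i near => near.
  by apply: (@iter_Vop_vanish _ M c H rho k.+1 _ _ (2 ^ k + 2 ^ k.+1 * (q %% L2))%N%:Z Hs); right; rewrite E.
by apply: (@iter_Vop_vanish _ M c H rho k.+1 _ _ (2 ^ k + 2 ^ k.+1 * (q %/ L2))%N%:Z Hs); left; rewrite E.
Qed.

Definition patch0 : 'I_N := 
  Ordinal (etrans (muln_gt0 L1 L2) (introT andP (conj L1_gt0 L2_gt0))).

Lemma patch_atom H rho (x : bool -> R) q : 0 < rho -> supp_in H rho (1 - rho) rho (1 - rho) ->
  (forall i, 0 <= x i <= 1) -> patch H x q = (patch0 == q)%:R * H (x false) (x true).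
Proof.
move=> rho0 Hs x01; case: eqP => [<-|nq].
  by rewrite /patch /= div0n mod0n !addr0 mul1r.
rewrite mul0r; apply/eqP; apply: contra_notT nq => /Hs[/andP[_ h1] /andP[_ h2]].
have /andP[x0 _] := x01 false; have /andP[y0 _] := x01 true.
have z1 : (q %/ L2)%N = 0%N.
  case E : (q %/ L2)%N => [//|m]; rewrite E in h1; exfalso; clear E.
  have : 1 <= m.+1%:R :> R by rewrite ler1n.
  by lra.
have z2 : (q %% L2)%N = 0%N.
  case E : (q %% L2)%N => [//|m]; rewrite E in h2; exfalso; clear E.
  have : 1 <= m.+1%:R :> R by rewrite ler1n.
  by lra.
by apply: val_inj => /=; rewrite (divn_eq q L2) z1 z2.
Qed.

Definition mask_norm : R :=
  \sum_(i < (M + M).+1) \sum_(l < (M + M).+1) `|c (i%:Z - M%:Z) (l%:Z - M%:Z)|.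

Lemma mask_norm_ge0 : 0 <= mask_norm.
Proof. by apply: sumr_ge0 => i _; apply: sumr_ge0. Qed.

Lemma mask_le_norm j k : `|c j k| <= mask_norm.
Proof.
have [->|cjk] := eqVneq (c j k) 0; first by rewrite normr0 mask_norm_ge0.
have [jM kM] : `|j| <= M%:Z /\ `|k| <= M%:Z.
  by split; rewrite leNgt; apply: contra_neqN cjk => h; apply: cM; rewrite h ?orbT.
have [i ->] := mask_ordinal jM; have [l ->] := mask_ordinal kM.
rewrite /mask_norm (bigD1 i) //= (bigD1 l) //= -addrA lerDl.
by apply: addr_ge0; [apply: sumr_ge0|apply: sumr_ge0 => ? _; apply: sumr_ge0].
Qed.

End Patches.

(** * The initial state *)

Section Init.
Variables (R : realType) (N : nat).

Definition coord (k : bool) : 'I_2 := if k then ord_max else ord0.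

(** P starts as the identity, so every product P x_k is linear in the input. *)
Definition cascade_init (x : 'I_2 -> R) : state N -> R := fun i =>
  match i with
  | inl (Some k) => x (coord k)
  | inl None => 0
  | inr (None, (q, q')) => (q == q')%:R
  | inr (Some k, (q, q')) => (q == q')%:R * x (coord k)
  end.

Lemma net_rep_init W B : 1 <= B -> net_rep W B 0 cascade_init.
Proof.
move=> B1; have B0 : 0 <= B by exact: le_trans B1.
have dB (b : bool) : `|b%:R : R| <= B by apply: le_trans B1; case: b; rewrite ?normr1 ?normr0.
exists (fun i j => match i with
  | inl (Some k) => (coord k == j)%:R
  | inr (Some k, (q, q')) => (q == q')%:R * (coord k == j)%:R
  | _ => 0 end),
  (fun i => if i is inr (None, (q, q')) then (q == q')%:R else 0); split.
  split; first by move=> [[k|]|[[k|] [q q']]] j; rewrite -?natrM ?mulnb ?normr0.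
  by move=> [[k|]|[[k|] [q q']]]; rewrite ?normr0.
move=> x [[k|]|[[k|] [q q']]] /=; rewrite ?addr0.
- by rewrite sum_delta.
- by rewrite big1 // => j _; rewrite mul0r.
- by under eq_bigr do rewrite -mulrA; rewrite -mulr_sumr sum_delta.
- by rewrite big1 ?add0r // => j _; rewrite mul0r.
Qed.

End Init.

(** * Choice of the constants for a given mask and atom *)

Section Main.
Variables (R : realType) (rho : R) (L1 L2 M K n : nat).
Variables (c : int -> int -> R) (H : R -> R -> R) (a b e : 'I_K -> R).
Hypothesis L1_gt0 : (0 < L1)%N.
Hypothesis L2_gt0 : (0 < L2)%N.
Hypothesis cM : mask_supported M c.
Hypothesis pw : preserves_window M c L1 L2.
Hypothesis rho_gt0 : 0 < rho.
Hypothesis Hsupp : supp_in H rho (1 - rho) rho (1 - rho).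
Hypothesis H_ge0 : forall x y, 0 <= H x y.
Hypothesis H_pieces : forall x y, exists i, H x y = a i * x + b i * y + e i.
Hypothesis H_cont : continuous (fun p : R * R => H p.1 p.2).
Hypothesis n_gt0 : (0 < n)%N.
Local Notation N := (L1 * L2)%N.

(** Bounds the column sums of all T_e, hence the growth of P per digit; the summand 1 keeps it at
    least 1. *)
Definition growth : R := 1 + N%:R * mask_norm M c.
(** Bounds both the coefficients of the pieces and H on the unit square. *)
Definition atom_norm : R := \sum_i (`|a i| + `|b i| + `|e i|).
(** The summands serve in turn the ramp condition 2^n <= rho B, the branch bound with its factor 3,
    and the size of the atom. *)
Definition weight_const : R := rho^-1 + 3 + atom_norm.
(** The base 2 [growth] dominates both the dyadic scaling 2^n and the products of n matrices. *)
Definition weight_bound : R := weight_const * (2 * growth) ^+ n.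

Let growth_ge1 : 1 <= growth.
Proof. by rewrite lerDl mulr_ge0 // mask_norm_ge0. Qed.

Let atom_norm_ge0 : 0 <= atom_norm.
Proof. by apply: sumr_ge0 => i _; rewrite !addr_ge0. Qed.

Lemma atom_norm_ge i : `|a i| + `|b i| + `|e i| <= atom_norm.
Proof.
rewrite /atom_norm (bigD1 i) //= lerDl.
by apply: sumr_ge0 => j _; rewrite !addr_ge0.
Qed.

Let rhoV_gt0 : 0 < rho^-1.
Proof. by rewrite invr_gt0. Qed.

Let growth_le : growth ^+ n <= (2 * growth) ^+ n.
Proof. by have g1 := growth_ge1; apply: lerXn2r; rewrite ?nnegrE; lra. Qed.

Let growth1_le : 2 * growth <= (2 * growth) ^+ n.
Proof.
have g1 := growth_ge1.
by rewrite -{1}[2 * growth]expr1; apply: ler_weXn2l => //; lra.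
Qed.

Let weight_ge (t u : R) : 0 <= t -> 0 <= u -> t <= weight_const ->
  u <= (2 * growth) ^+ n -> t * u <= weight_bound.
Proof. by move=> *; apply: ler_pM. Qed.

Let weight_ge_const t : 0 <= t -> t <= weight_const -> t <= weight_bound.
Proof.
have g1 := growth_ge1; have g2 := growth1_le.
by move=> t0 tw; rewrite -[t]mulr1; apply: weight_ge => //; lra.
Qed.

Let data_B2 : 2 <= weight_bound.
Proof.
have a0 := atom_norm_ge0; have r0 := rhoV_gt0.
by apply: weight_ge_const => //; rewrite /weight_const; lra.
Qed.

Let data_TB (d : {ffun bool -> bool}) (q q' : 'I_N) : `|refine_coef c d q q'| <= weight_bound.
Proof.
have a0 := atom_norm_ge0; have r0 := rhoV_gt0.
rewrite -[X in X <= _]mul1r; apply: weight_ge => //; first by rewrite /weight_const; lra.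
apply: le_trans growth1_le; apply: (le_trans (mask_le_norm cM _ _)).
have N1 : 1 <= N%:R :> R by rewrite ler1n muln_gt0 L1_gt0.
have m0 := mask_norm_ge0 M c.
have : mask_norm M c <= N%:R * mask_norm M c by rewrite ler_peMl.
rewrite /growth; lra.
Qed.

Let data_aB i : `|a i| <= weight_bound.
Proof.
have r0 := rhoV_gt0; apply: weight_ge_const => //; rewrite /weight_const.
by have := atom_norm_ge i; have := normr_ge0 (b i); have := normr_ge0 (e i); lra.
Qed.

Let data_bB i : `|b i| <= weight_bound.
Proof.
have r0 := rhoV_gt0; apply: weight_ge_const => //; rewrite /weight_const.
by have := atom_norm_ge i; have := normr_ge0 (a i); have := normr_ge0 (e i); lra.
Qed.

Let data_eB i : `|e i| <= weight_bound.
Proof.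
have r0 := rhoV_gt0; apply: weight_ge_const => //; rewrite /weight_const.
by have := atom_norm_ge i; have := normr_ge0 (a i); have := normr_ge0 (b i); lra.
Qed.

Lemma cascade_correct : exists cd : cascade_data R N K, cd_B cd = weight_bound /\
  forall (x : 'I_2 -> R) q, (forall k, 0 <= x (coord k) <= 1) ->
    cascade_out (patch0 L1_gt0 L2_gt0) cd (iter n (cascade_step cd) (cascade_init x)) q =
    patch (iter n (Vop M c) H) (fun k => x (coord k)) q.
Proof.
have g1 := growth_ge1; have a0 := atom_norm_ge0; have r0 := rhoV_gt0.
have [chi [chi_lower chi_upper]] := cpwl_lattice H_cont H_pieces.
exists (CascadeData chi data_B2 data_TB data_aB data_bB data_eB); split=> // x q x01.
set cd := CascadeData _ _ _ _ _ _.
pose F k (y : bool -> R) (r : 'I_N) := patch (iter k (Vop M c) H) y r.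
pose target := F n (fun k => x (coord k)).
have rhoB : 2 ^+ n <= rho * cd_B cd.
  have h1 : (2 : R) ^+ n <= (2 * growth) ^+ n by apply: lerXn2r; rewrite ?nnegrE; lra.
  have h2 : 1 <= rho * weight_const.
    rewrite /weight_const -addrA mulrDr divff ?gt_eqF // lerDl.
    by apply: mulr_ge0; [exact: ltW|exact: addr_ge0].
  rewrite /= mulrA; apply: (le_trans h1); rewrite ler_peMl //.
  by apply: exprn_ge0; lra.
have T_sum (d : {ffun bool -> bool}) (r : 'I_N) : \sum_q' `|cd_T cd d q' r| <= growth.
  apply: (@le_trans _ _ (\sum_(q' < N) mask_norm M c)).
    by apply: ler_sum => q' _; exact: mask_le_norm.
  by rewrite sumr_const card_ord -mulr_natl lerDr.
have QB : 3 * growth ^+ n <= cd_B cd.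
  apply: weight_ge => //; first by apply: exprn_ge0; lra.
  by rewrite /weight_const; lra.
have hmaxB : atom_norm * growth ^+ n <= cd_B cd.
  apply: weight_ge => //; first by apply: exprn_ge0; lra.
  by rewrite /weight_const; lra.
have F_refine k (d : {ffun bool -> bool}) (y y' : bool -> R) r :
    (forall i, 0 <= y i <= 1) -> (forall i, 0 <= y' i <= 1) ->
    (forall i, y' i = 2 * y i - (d i)%:R) ->
    F k.+1 y r = \sum_r' cd_T cd d r r' * F k y' r'.
  move=> _ y'01 y'E; apply: patch_refine => //.
  exact: open_window_iter rho_gt0 Hsupp.
have F_vanish k i (y : bool -> R) r : 2 ^+ k.+1 * `|y i - 2^-1| < rho -> F k.+1 y r = 0.
  exact: patch_vanish Hsupp.
have F0 (y : bool -> R) r : (forall i, 0 <= y i <= 1) ->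
    F 0%N y r = (patch0 L1_gt0 L2_gt0 == r)%:R * H (y false) (y true).
  exact: patch_atom rho_gt0 Hsupp.
have h01 (y : bool -> R) : (forall i, 0 <= y i <= 1) -> 0 <= H (y false) (y true) <= atom_norm.
  move=> y01; rewrite H_ge0 /=; have [i ->] := H_pieces (y false) (y true).
  apply: le_trans (atom_norm_ge i); have /andP[u0 u1] := y01 false; have /andP[v0 v1] := y01 true.
  apply: lerD; last exact: ler_norm.
  apply: lerD; apply: (le_trans (ler_norm _)); rewrite normrM ler_piMr // ger0_norm //.
have start : valid_state n F target growth 0 (cascade_init x).
  left; split=> //.
  - by move=> r; rewrite subn0 (sum_delta r).
  - by move=> k r r'; rewrite /st_prod /= mulrC.
  - by move=> r r'; exact: normr_delta.
  - by split; [rewrite /st_flag|left].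
have end_valid := valid_iter F_refine F_vanish rho_gt0 rhoB growth_ge1 T_sum QB start.
exact: (cascade_out_valid growth_ge1 (q0 := patch0 L1_gt0 L2_gt0)
  (h := fun y => H (y false) (y true)) F0 h01 hmaxB
  (fun y => chi_lower (y false) (y true)) (fun y => chi_upper (y false) (y true)) q end_valid).
Qed.

End Main.

Theorem mainTheorem10 (R : realType) (rho : R) (L1 L2 M K : nat) :
  0 < rho < 2^-1 -> (0 < L1)%N -> (0 < L2)%N ->
  exists C0 C1 : nat, (0 < C0)%N /\ (0 < C1)%N /\
  forall (c : int -> int -> R) (H : R -> R -> R),
    mask_supported M c ->
    preserves_window M c L1 L2 ->
    special_atom rho H -> CPwL_pieces K H ->
    exists C2 Lambda : R, 0 < C2 /\ 0 < Lambda /\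
    forall n : nat, (1 <= n)%N ->
      exists g : 'cV[R]_2 -> 'cV[R]_(L1 * L2),
        Upsilon_bounded C0 (C1 * n)%N 2 (L1 * L2)%N (C2 * Lambda ^+ n) g /\
        forall x : 'cV[R]_2, 0 <= cx x <= 1 -> 0 <= cy x <= 1 ->
          g x = Vec L1 L2 (iter n (Vop M c) H) (cx x) (cy x).
Proof.
move=> /andP[rho_gt0 _] L1_gt0 L2_gt0.
(* The sizes of the step and output networks are fixed here, before mask, atom and n are
   introduced. *)
have [Ws [Ls step_rep]] := uniform_rep_step R (L1 * L2) K.
have [Wo [Lo out_rep]] := uniform_rep_out R K (patch0 L1_gt0 L2_gt0).
pose S := state (L1 * L2).
pose W := (Ws + Wo + (#|{: S}| + #|{: S}|) + (L1 * L2 + L1 * L2))%N.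
exists W.+1, (Ls.+1 + Lo.+1)%N; split=> //; split=> // c H cM pw [_ H_ge0 Hsupp].
move=> [H_cont [a [b [e H_pieces]]]].
exists (weight_const rho a b e), (2 * growth L1 L2 M c).
have m0 := mask_norm_ge0 M c.
have g1 : 1 <= growth L1 L2 M c by rewrite lerDl mulr_ge0.
have a0 : 0 <= atom_norm a b e by apply: sumr_ge0 => i _; rewrite !addr_ge0.
have rV : 0 < rho^-1 by rewrite invr_gt0.
split; first by rewrite /weight_const; lra.
split; first by lra.
move=> n n_gt0.
have [cd [cdB correct]] :=
  cascade_correct L1_gt0 L2_gt0 cM pw rho_gt0 Hsupp H_ge0 H_pieces H_cont n_gt0.
have B1 : 1 <= cd_B cd by apply: le_trans (cd_B2 cd); rewrite ler1n.
have SW : (#|{: S}| + #|{: S}| <= W.+1)%N by rewrite /W; lia.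
have sr : net_rep W.+1 (cd_B cd) Ls (cascade_step cd).
  by apply: net_rep_widen (step_rep cd); rewrite /W; lia.
have or : net_rep W.+1 (cd_B cd) Lo (cascade_out (patch0 L1_gt0 L2_gt0) cd).
  by apply: net_rep_widen (out_rep cd); rewrite /W; lia.
have nr := net_rep_comp SW (net_rep_iter n SW (net_rep_init (L1 * L2) W.+1 B1) sr) or.
have [L LE] : exists L, ((Ls.+1 + Lo.+1) * n)%N = L.+1.
  by exists ((Ls.+1 + Lo.+1) * n).-1; rewrite prednK // muln_gt0.
(* The depth (Ls + 1) n + Lo + 1 is padded to exactly (Ls + 1 + Lo + 1) n, which is possible because
   n >= 1. *)
have nr' : net_rep W.+1 (cd_B cd) L.+1 (fun x =>
    cascade_out (patch0 L1_gt0 L2_gt0) cd (iter n (cascade_step cd) (cascade_init x))).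
  apply: net_rep_deepen nr => //; first by rewrite card_ord /W; lia.
  rewrite -LE mulnDl addnC addSn -addnS leq_add2l.
  by rewrite -{1}[Lo.+1]muln1 leq_mul2l.
have B0 : 0 <= cd_B cd by exact: le_trans B1.
have := net_rep_Upsilon B0 nr'; rewrite -LE cdB => up.
eexists; split; first exact: up.
move=> x x0 x1; apply/colP => q; rewrite !mxE correct //.
by case.
Qed.
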